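(* There exists a real number $\gamma$ with $0<\gamma<\frac{1}{2}$ such that $g(n)\le g_1(n)<n^{\gamma}$ for all sufficiently large integers $n$.
   Context: For integers $n>1$ and $k\ge 1$, say that $(n,k)$ has a prime representation if there are distinct primes $P_1,\dots,P_k$ with $P_j\mid (n+j)$ for $1\le j\le k$; $g(n)$ is the largest positive integer $k$ such that $(n,k)$ has a prime representation. For an integer $\nu>1$, $\omega(\nu)$ is the number of distinct prime divisors of $\nu$, and $\omega(1)=0$. $g_1(n)$ is the largest positive integer $k$ such that $\omega\big(\prod_{i=1}^{l}(n+i)\big)\ge l$ for all $1\le l\le k$. *)

(* Defs.v *)
From Stdlib Require Import Reals.
From mathcomp Require Import all_boot.
Set Implicit Arguments. Unset Strict Implicit. Unset Printing Implicit Defensive.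

Definition omega (m : nat) : nat := size (primes m).

(* (n,k) has a prime representation: distinct primes P_1..P_k with P_j | n + j.
   Index j : 'I_k stands for j.+1 in {1..k}. *)
Definition prime_rep (n k : nat) : Prop :=
  exists P : 'I_k -> nat, injective P /\
    forall j : 'I_k, prime (P j) /\ P j %| n + j.+1.

Definition is_g (n k : nat) : Prop :=
  0 < k /\ prime_rep n k /\ forall k', 0 < k' -> prime_rep n k' -> k' <= k.

Definition g1_prop (n k : nat) : Prop :=
  forall l, 1 <= l <= k -> l <= omega (\prod_(1 <= i < l.+1) (n + i)).

Definition is_g1 (n k : nat) : Prop :=
  0 < k /\ g1_prop n k /\ forall k', 0 < k' -> g1_prop n k' -> k' <= k.

(* Main.v *)
Require Import Defs.
From Stdlib Require Import Reals.
From Stdlib Require Lra.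
From mathcomp Require Import all_boot.
From mathcomp Require Import order ssralg ssrnum cyclic archimedean.
From mathcomp Require Import boolp reals exp sequences Rstruct zify ring lra.
Set Implicit Arguments. Unset Strict Implicit. Unset Printing Implicit Defensive.
Import Order.TTheory GRing.Theory Num.Theory.
Local Open Scope ring_scope.

(* Take k = n^(1/2 - c) and suppose that the block n+1, ..., n+k has at least k
   prime divisors.  Those exceeding k divide 'C(n + k, k) <= (4 (n + k) / k)^k,
   roughly n^((1/2 + c) k), while there are almost k of them since the primes up
   to k are o(k).  Comparing logarithms, a positive proportion of k of them lie in
   (k, k n^(c')], where c' is a constant multiple of c.

   That is impossible for small c, by Selberg's sieve applied to
   the pairs (d, m) with n < d m <= n + k, sieved on d up to a small fixed power z
   of n: the range of d has logarithmic width O(c) ln n, and sieving gains a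
   factor ln z.  The level of distribution needed, which lies beyond the trivial
   range d <= k, amounts to a power saving in sum_d ({y / d} - 1/2) over d near
   y^(1/2).  There d is cut into runs of length q on which y / d is close to a
   linear function of slope a / q; the sum over such a run is O(1).  Runs with
   small q are rare because y / d^2 is then close to one of few fractions. *)

(** * The Selberg sieve *)

(** The test [0 < n] matters: [primes 0] is empty, and the value 0 at 0 makes the index 0 harmless
    in sums over [r < z.+1]. *)
Definition mobius (R : pzRingType) (n : nat) : R :=
  if (0 < n)%N && all (fun p => logn p n == 1%N) (primes n)
  then (-1) ^+ size (primes n) else 0.

Lemma mobius0 (R : pzRingType) : mobius R 0 = 0.
Proof. by []. Qed.

Lemma mobius1 (R : pzRingType) : mobius R 1 = 1.
Proof. by rewrite /mobius /= expr0. Qed.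

Lemma mobius_sqr_dvd (R : pzRingType) (p d : nat) :
  prime p -> p %| d -> mobius R (p * d) = 0.
Proof.
move=> p_pr pd; rewrite /mobius; case: ifP => // /andP[].
rewrite muln_gt0 => /andP[p0 d0] /allP/(_ p); rewrite primesM // mem_primes.
rewrite p_pr p0 dvdnn => /(_ isT); rewrite lognM // lognE p_pr p0 dvdnn divnn p0 /=.
by rewrite logn1 eqSS -leqn0 leqNgt logn_gt0 mem_primes p_pr d0 pd.
Qed.

Lemma mobius_prime_mul (R : pzRingType) (p d : nat) :
  prime p -> ~~ (p %| d)%N -> mobius R (p * d) = - mobius R d.
Proof.
move=> p_pr pNd; rewrite /mobius.
case: (posnP d) => [->|d0]; first by rewrite muln0 /= oppr0.
have p0 := prime_gt0 p_pr.
have pE : perm_eq (primes (p * d)) (p :: primes d).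
  apply: uniq_perm; rewrite ?primes_uniq //= ?primes_uniq ?mem_primes ?(negPf pNd) ?andbF //.
  by move=> q; rewrite primesM // primes_prime // !inE.
rewrite (perm_size pE) (perm_all _ pE) /= muln_gt0 p0 d0 /=.
rewrite {1}lognM // (logn_prime p p_pr) eqxx.
have -> : logn p d = 0%N by apply/eqP; rewrite -leqn0 leqNgt logn_gt0 mem_primes (negPf pNd) !andbF.
rewrite /= exprS mulN1r.
rewrite (@eq_in_all _ _ (fun q => logn q d == 1%N)); first by case: ifP; rewrite ?oppr0.
move=> q; rewrite mem_primes => /and3P[q_pr _ qd].
rewrite lognM // (logn_prime q p_pr); case: (q =P p) => // qp.
by move: pNd; rewrite -qp qd.
Qed.

(** For [n > 1], fix a prime [p] with [n = p * m]. Among the divisors [p * g] with [g %| m], those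
    with [p %| g] contribute 0, and the others cancel against the divisors [g] of [n] prime to
    [p]. *)
Lemma sum_mobius (R : pzRingType) (N n : nat) : (0 < n < N)%N ->
  \sum_(f < N | f %| n) mobius R f = (n == 1%N)%:R.
Proof.
case/andP=> n0 nN; case: eqP => [->|/eqP n1].
  have N1 : (1 < N)%N by lia.
  rewrite (bigD1 (Ordinal N1)) //= mobius1 big1 ?addr0 // => i /andP[].
  by rewrite dvdn1 => /eqP i1 /eqP []; apply/val_inj.
have [p p_pr pn] : exists2 p, prime p & p %| n by exists (pdiv n); rewrite ?pdiv_prime ?pdiv_dvd //; lia.
have p0 := prime_gt0 p_pr.
have [m nE] : exists m, n = (p * m)%N by exists (n %/ p)%N; rewrite mulnC divnK.
have m0 : (0 < m)%N by move: n0; rewrite nE muln_gt0 => /andP[].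
have mN : (p * m < N)%N by rewrite -nE.
rewrite (bigID (fun f : 'I_N => p %| f)) /=.
pose h (g : 'I_N) : 'I_N := insubd g (p * g)%N.
pose h' (f : 'I_N) : 'I_N := insubd f (f %/ p)%N.
rewrite (reindex_onto h h') /=; last first.
  move=> f /andP[fn pf]; apply/val_inj; rewrite /h /h' !val_insubd.
  by rewrite (leq_ltn_trans (leq_div _ _) (ltn_ord f)) mulnC divnK ?ltn_ord.
rewrite (eq_bigl (fun g : 'I_N => g %| m)); last first.
  move=> g; apply/idP/idP => [/andP[/andP[h1 h2] /eqP h3]|gm].
    have := congr1 val h3; rewrite /h' /h !val_insubd.
    move: h1 h2; rewrite /h val_insubd; case: ifP => pgN.
      by rewrite nE dvdn_pmul2l.
    (* Out of range, [h g] is the default [g]; the round trip then forces [g %/ p = g], hence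
       [g = 0], whose multiple is in range after all. *)
    rewrite (leq_ltn_trans (leq_div _ _) (ltn_ord g)) => _ pg gE0.
    have := divnK pg; rewrite gE0 => gE.
    have g0 : val g = 0%N by move: (prime_gt1 p_pr) gE => /=; nia.
    by move: pgN; rewrite g0 muln0; lia.
  have pgN : (p * g < N)%N.
    have gm2 : (g <= m)%N by apply: dvdn_leq.
    by apply: leq_ltn_trans mN; rewrite leq_pmul2l.
  rewrite {1 2}/h val_insubd pgN nE dvdn_pmul2l // gm dvdn_mulr //=.
  by apply/eqP/val_inj; rewrite /h' /h !val_insubd pgN mulKn // ltn_ord.
rewrite (eq_bigr (fun g : 'I_N => mobius R (p * g))); last first.
  move=> g gm; rewrite /h val_insubd.
  by rewrite (leq_ltn_trans _ mN) // leq_pmul2l // dvdn_leq.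
rewrite (bigID (fun f : 'I_N => p %| f)) /= big1 ?add0r; last first.
  by move=> g /andP[_ pg]; rewrite mobius_sqr_dvd.
rewrite (eq_bigr (fun g : 'I_N => - mobius R g)); last first.
  by move=> g /andP[_ pg]; rewrite mobius_prime_mul.
rewrite sumrN addrC; apply/eqP; rewrite subr_eq0; apply/eqP/eq_bigl => g.
case: (boolP (p %| g)%N); rewrite ?andbF ?andbT // => pg.
by rewrite nE Gauss_dvdr // coprime_sym prime_coprime.
Qed.

Lemma mobius_abs_le1 (R : numDomainType) (n : nat) : `|mobius R n| <= 1.
Proof. by rewrite /mobius; case: ifP; rewrite ?normr0 ?normrX ?normrN1 ?expr1n. Qed.

Lemma mobius_sqr_abs (R : numDomainType) (n : nat) : `|mobius R n| = mobius R n ^+ 2.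
Proof.
rewrite /mobius; case: ifP; rewrite ?normr0 ?expr0n //.
by rewrite normrX normrN1 expr1n -exprM mulnC exprM sqrrN expr1n expr1n.
Qed.

Definition selberg_sum (R : fieldType) (z : nat) : R :=
  \sum_(r < z.+1) mobius R r ^+ 2 / r%:R.

(* Selberg's optimal choice has [totient r] in place of [r]; with [r], the sum
   to be compared with [ln z] is [selberg_sum], which is handled by writing
   integers as [r * j ^ 2] with [r] squarefree. *)
Definition selberg_y (R : fieldType) (z r : nat) : R :=
  mobius R r / (r%:R * selberg_sum R z).

(** Möbius inverse of [selberg_y] over multiples. The usual sieve weight of [e] is [e] times this
    value. *)
Definition selberg_ell (R : fieldType) (z e : nat) : R :=
  \sum_(r < z.+1 | e %| r) mobius R (r %/ e) * selberg_y R z r.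

Lemma selberg_ell0 (R : fieldType) z : selberg_ell R z 0 = 0.
Proof.
apply: big1 => r; rewrite dvd0n => /eqP ->.
by rewrite /selberg_y mobius0 mul0r ?mulr0.
Qed.

(** Orthogonality behind the inversion: when [s %| r], the substitution [e = r %/ f] turns the sum
    into [sum_mobius] for [r %/ s]. *)
Lemma sum_mobius_quot (R : pzRingType) (N r s : nat) : (0 < r < N)%N -> (0 < s)%N ->
  \sum_(e < N | (s %| e) && (e %| r)) mobius R (r %/ e) = (r == s)%:R.
Proof.
move=> /andP[r0 rN] s0.
case: (boolP (s %| r)%N) => [/dvdnP[m rE]|sNr]; last first.
  rewrite big1; first by case: eqP sNr => // ->; rewrite dvdnn.
  by move=> e /andP[se er]; rewrite (dvdn_trans se er) in sNr.
have m0 : (0 < m)%N by move: r0; rewrite rE muln_gt0 => /andP[].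
have mN : (0 < m < N)%N by rewrite m0 (leq_ltn_trans _ rN) // rE leq_pmulr.
transitivity ((m == 1%N)%:R : R); last first.
  by congr (_ %:R : R); congr nat_of_bool; rewrite rE -{2}[s]mul1n eqn_pmul2r.
rewrite -(sum_mobius R mN).
pose h (f : 'I_N) : 'I_N := insubd f (r %/ f)%N.
have hE (f : 'I_N) : val (h f) = (r %/ f)%N.
  by rewrite /h val_insubd (leq_ltn_trans (leq_div _ _) rN).
rewrite (reindex_onto h h) /=; last first.
  move=> e /andP[_ er]; apply/val_inj; rewrite !hE.
  have e0 : (0 < e)%N by rewrite (dvdn_gt0 r0).
  by case/dvdnP: er r0 => u -> ; rewrite muln_gt0 => /andP[u0 _]; rewrite mulnK // mulKn.
apply: congr_big => // f.
- rewrite /= !hE; apply/idP/idP.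
    move=> /andP[/andP[h1 h2] /eqP/(congr1 val)]; rewrite /= !hE => h3.
    have fr : f %| r.
      by rewrite -h3; apply/dvdnP; exists (r %/ f)%N; rewrite mulnC divnK.
    have f0 : (0 < f)%N by rewrite (dvdn_gt0 r0).
    rewrite -(dvdn_pmul2r s0) -rE; case/dvdnP: h1 => u uE.
    by apply/dvdnP; exists u; rewrite -(divnK fr) uE; ring.
  case/dvdnP => u mE.
  have f0 : (0 < f)%N by move: m0; rewrite mE muln_gt0 => /andP[].
  have u0 : (0 < u)%N by move: m0; rewrite mE muln_gt0 => /andP[].
  have rfE : (r %/ f = u * s)%N by rewrite rE mE -mulnA mulnCA mulKn //.
  rewrite rfE dvdn_mull //= rE mE; apply/andP; split.
    by apply/dvdnP; exists f; ring.
  apply/eqP/val_inj; rewrite /= !hE rfE rE mE.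
  by rewrite -mulnA mulnCA mulnK // muln_gt0 u0.
- rewrite /= !hE => /andP[/andP[h1 h2] /eqP/(congr1 val)]; rewrite /= !hE.
  by move=> ->.
Qed.

Lemma selberg_ell_inv (R : fieldType) (z s : nat) : (s <= z)%N ->
  \sum_(e < z.+1 | s %| e) selberg_ell R z e = selberg_y R z s.
Proof.
move=> sz; case: (posnP s) => [->|s0].
  rewrite big1; first by rewrite /selberg_y mobius0 mul0r.
  by move=> e; rewrite dvd0n => /eqP ->; rewrite selberg_ell0.
rewrite /selberg_ell.
rewrite (exchange_big_dep xpredT) //=.
have s1 : (s < z.+1)%N by [].
transitivity (\sum_(r < z.+1) (if r == Ordinal s1 then selberg_y R z r else 0)); last first.
  by rewrite -big_mkcond big_pred1_eq.
apply: eq_bigr => r _; rewrite -mulr_suml; case: (posnP r) => [r0|r0].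
  by rewrite r0 /selberg_y mobius0 mul0r mulr0; case: ifP.
rewrite sum_mobius_quot ?r0 ?ltn_ord // -val_eqE /=.
by case: ifP; rewrite ?mul1r ?mul0r.
Qed.

Lemma sum_totient_gcd (N a b : nat) : (0 < gcdn a b < N)%N ->
  (\sum_(r < N | (r %| a) && (r %| b)) totient r = gcdn a b)%N.
Proof.
case/andP=> g0 gN; rewrite -[RHS]sum_totient_dvd.
rewrite [RHS](big_ord_widen_cond N (fun r => r %| gcdn a b) totient) //.
apply: eq_bigl => r; rewrite -dvdn_gcd ltnS.
by case: (boolP (r %| gcdn a b)%N) => //= /(dvdn_leq g0) ->.
Qed.

Lemma selberg_sum_gt0 (R : realFieldType) z : (0 < z)%N -> 0 < selberg_sum R z.
Proof.
move=> z0; have z1 : (1 < z.+1)%N by [].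
rewrite /selberg_sum (bigD1 (Ordinal z1)) //= mobius1 expr1n divr1.
by rewrite ltr_pwDl // sumr_ge0 // => i _; rewrite divr_ge0 ?sqr_ge0 ?ler0n.
Qed.

(** Writing the gcd as a sum of totients over common divisors diagonalises the form into the sum of
    [totient r * selberg_y z r ^ 2]. With [totient r <= r] each term is at most
    [mobius r ^ 2 / r / S ^ 2], where [S] is [selberg_sum], and these add up to [1 / S]. *)
Lemma selberg_quad (R : realFieldType) z : (0 < z)%N ->
  \sum_(e1 < z.+1) \sum_(e2 < z.+1)
     selberg_ell R z e1 * selberg_ell R z e2 * (gcdn e1 e2)%:R <= (selberg_sum R z)^-1.
Proof.
move=> z0; have S0 := selberg_sum_gt0 R z0.
pose l := selberg_ell R z.
have -> : \sum_(e1 < z.+1) \sum_(e2 < z.+1) l e1 * l e2 * (gcdn e1 e2)%:R =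
    \sum_(r < z.+1) (totient r)%:R * selberg_y R z r ^+ 2.
  transitivity (\sum_(e1 < z.+1) \sum_(e2 < z.+1) \sum_(r < z.+1 | (r %| e1) && (r %| e2))
      (totient r)%:R * (l e1 * l e2)).
    apply: eq_bigr => e1 _; apply: eq_bigr => e2 _.
    rewrite -mulr_suml -natr_sum mulrC.
    case: (posnP e1) => [->|e10]; first by rewrite /l selberg_ell0 !mul0r !mulr0.
    rewrite sum_totient_gcd // gcdn_gt0 e10 /= (leq_ltn_trans _ (ltn_ord e1)) //.
    by rewrite dvdn_leq // dvdn_gcdl.
  under eq_bigr => e1 _ do rewrite (exchange_big_dep xpredT) //=.
  rewrite exchange_big /=; apply: eq_bigr => r _.
  rewrite -selberg_ell_inv; last by rewrite -ltnS.
  rewrite expr2 mulr_suml mulr_sumr [RHS]big_mkcond; apply: eq_bigr => e1 _.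
  case: ifP => re1; last by rewrite big_pred0_eq.
  by rewrite mulr_sumr mulr_sumr; apply: eq_bigr => e2 _.
have -> : (selberg_sum R z)^-1 =
    \sum_(r < z.+1) (mobius R r ^+ 2 / r%:R) / selberg_sum R z ^+ 2.
  by rewrite -mulr_suml -/(selberg_sum R z); field; rewrite gt_eqF.
apply: ler_sum => r _; rewrite /selberg_y.
case: (posnP r) => [->|r0]; first by rewrite mobius0 !mul0r expr0n /= !(mul0r, mulr0).
have rR : 0 < r%:R :> R by rewrite ltr0n.
have -> : (mobius R r / (r%:R * selberg_sum R z)) ^+ 2 =
   r%:R^-1 * (mobius R r ^+ 2 / r%:R / selberg_sum R z ^+ 2).
  by field; rewrite !gt_eqF.
rewrite mulrA ler_piMl //.
  by rewrite !divr_ge0 ?sqr_ge0 ?ltW.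
rewrite ler_pdivrMr // mul1r ler_nat.
rewrite -[leqRHS]sum_totient_dvd (bigD1 (@ord_max r)) //= leq_addr //.
Qed.

Lemma selberg_ell1 (R : realFieldType) z : (0 < z)%N -> selberg_ell R z 1 = 1.
Proof.
move=> z0; have S0 := selberg_sum_gt0 R z0.
rewrite /selberg_ell (eq_bigl xpredT) => [|r]; last by rewrite dvd1n.
transitivity (\sum_(r < z.+1) (mobius R r ^+ 2 / r%:R) / selberg_sum R z).
  apply: eq_bigr => r _; rewrite divn1 /selberg_y invfM expr2; ring.
by rewrite -mulr_suml divff // gt_eqF.
Qed.

Lemma selberg_ell_le1 (R : realFieldType) z e : (0 < z)%N -> `|selberg_ell R z e| <= 1.
Proof.
move=> z0; have S0 := selberg_sum_gt0 R z0.
apply: le_trans (ler_norm_sum _ _ _) _; rewrite big_mkcond /=.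
have -> : 1 = \sum_(r < z.+1) (mobius R r ^+ 2 / r%:R) / selberg_sum R z.
  by rewrite -mulr_suml divff // gt_eqF.
apply: ler_sum => r _; case: ifP => _; last first.
  by rewrite !divr_ge0 ?sqr_ge0 ?ler0n // ltW.
rewrite normrM -[leRHS]mul1r ler_pM // ?mobius_abs_le1 //.
rewrite /selberg_y normrM mobius_sqr_abs ger0_norm ?invfM ?mulrA //.
by rewrite mulr_ge0 // invr_ge0 ?ler0n // ltW.
Qed.

(** A prime [d > z] has no divisor [e <= z] except 1, where the weight is 1, so the squared divisor
    sum majorises the indicator. Expanding the square leaves sums of [w] over multiples of
    [lcmn e1 e2 <= z ^ 2], whose main terms form [selberg_quad]. *)
Lemma selberg_sieve (R : realFieldType) (z B : nat) (w : nat -> R) (X Rm : R) :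
  (0 < z)%N -> 0 <= X -> (forall d, 0 <= w d) ->
  (forall e, (0 < e <= z ^ 2)%N -> `|\sum_(d < B | e %| d) w d - X / e%:R| <= Rm) ->
  \sum_(d < B | prime d && (z < d)%N) w d <= X / selberg_sum R z + z%:R ^+ 4 * Rm.
Proof.
move=> z0 X0 w0 hA; pose l e := e%:R * selberg_ell R z e.
have Rm0 : 0 <= Rm by apply: le_trans (hA 1%N _); rewrite ?normr_ge0 // expn_gt0 z0.
pose A e := \sum_(d < B | e %| d) w d.
have step1 : \sum_(d < B | prime d && (z < d)%N) w d <=
    \sum_(d < B) w d * (\sum_(e < z.+1 | e %| d) l e) ^+ 2.
  rewrite big_mkcond; apply: ler_sum => d _; case: ifP; last first.
    by rewrite mulr_ge0 ?sqr_ge0.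
  case/andP=> d_pr zd; have z1 : (1 < z.+1)%N by [].
  rewrite (big_pred1 (Ordinal z1)) => [|e /=].
    by rewrite /l /= mul1r selberg_ell1 // expr1n mulr1.
  rewrite -val_eqE /=; apply/idP/eqP => [|->]; last exact: dvd1n.
  case/primeP: d_pr => _ h /h /orP[/eqP //|/eqP ed].
  by have := ltn_ord e; rewrite ed ltnS leqNgt zd.
apply: le_trans step1 _.
have -> : \sum_(d < B) w d * (\sum_(e < z.+1 | e %| d) l e) ^+ 2 =
    \sum_(e1 < z.+1) \sum_(e2 < z.+1) l e1 * l e2 * A (lcmn e1 e2).
  transitivity (\sum_(d < B) \sum_(e1 < z.+1) \sum_(e2 < z.+1)
      if (e1 %| d) && (e2 %| d) then l e1 * l e2 * w d else 0).
    apply: eq_bigr => d _; rewrite expr2 mulr_suml mulr_sumr big_mkcond.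
    apply: eq_bigr => e1 _; case: ifP => /= e1d; last by rewrite big1.
    rewrite mulr_sumr mulr_sumr big_mkcond; apply: eq_bigr => e2 _.
    by case: ifP => // _; rewrite mulrC.
  rewrite exchange_big; apply: eq_bigr => e1 _; rewrite exchange_big; apply: eq_bigr => e2 _.
  rewrite /A mulr_sumr [RHS]big_mkcond; apply: eq_bigr => d _.
  by rewrite dvdn_lcm.
(* The crude bound [z] on the weights costs only the factor [z ^ 4] in the remainder: [z ^ 2] pairs,
   each contributing at most [z ^ 2 * Rm]. *)
have lz (e : 'I_z.+1) : `|l e| <= z%:R.
  rewrite /l normrM normr_nat -[leRHS]mulr1 ler_pM ?ler0n ?selberg_ell_le1 //.
  by rewrite ler_nat -ltnS.
have l00 : l 0%N = 0 by rewrite /l mul0r.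
have term (e1 e2 : 'I_z.+1) : l e1 * l e2 * A (lcmn e1 e2) <=
   X * (selberg_ell R z e1 * selberg_ell R z e2 * (gcdn e1 e2)%:R) +
   (if (0 < e1)%N && (0 < e2)%N then z%:R ^+ 2 * Rm else 0).
  case: (posnP e1) => [->|e10] /=; first by rewrite l00 selberg_ell0 !mul0r mulr0 addr0.
  case: (posnP e2) => [->|e20] /=; first by rewrite l00 selberg_ell0 !(mul0r, mulr0) addr0.
  have L0 : (0 < lcmn e1 e2)%N by rewrite lcmn_gt0 e10.
  have Lz : (lcmn e1 e2 <= z ^ 2)%N.
    apply: (@leq_trans (e1 * e2)%N); last by rewrite leq_mul // -ltnS ltn_ord.
    by rewrite dvdn_leq ?muln_gt0 ?e10 // -muln_lcm_gcd dvdn_mulr.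
  have := hA _ (introT andP (conj L0 Lz)); rewrite -/(A _) => hL.
  have -> : X * (selberg_ell R z e1 * selberg_ell R z e2 * (gcdn e1 e2)%:R) =
      l e1 * l e2 * (X / (lcmn e1 e2)%:R).
    have h : (lcmn e1 e2)%:R * (gcdn e1 e2)%:R = e1%:R * e2%:R :> R.
      by rewrite -!natrM muln_lcm_gcd.
    have L1 : (lcmn e1 e2)%:R != 0 :> R by rewrite pnatr_eq0 -lt0n.
    have -> : (gcdn e1 e2)%:R = e1%:R * e2%:R / (lcmn e1 e2)%:R :> R.
      by rewrite -h mulrAC divff // mul1r.
    by rewrite /l; ring.
  rewrite -lerBlDl -mulrBr; apply: le_trans (ler_norm _) _.
  rewrite normrM expr2 ler_pM //.
  by rewrite normrM ler_pM.
apply: (@le_trans _ _ (\sum_(e1 < z.+1) \sum_(e2 < z.+1)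
   (X * (selberg_ell R z e1 * selberg_ell R z e2 * (gcdn e1 e2)%:R) +
   (if (0 < e1)%N && (0 < e2)%N then z%:R ^+ 2 * Rm else 0)))).
  by apply: ler_sum => e1 _; apply: ler_sum => e2 _; apply: term.
under eq_bigr => e1 _ do rewrite big_split /= -mulr_sumr.
rewrite big_split /= -mulr_sumr; apply: lerD; first by rewrite ler_wpM2l // selberg_quad.
rewrite big_ord_recl /= big1 ?add0r => [|i _ //].
under eq_bigr => e1 _ do rewrite big_ord_recl /= add0r sumr_const card_ord.
rewrite sumr_const card_ord -(mulr_natl (_ *+ z)) -(mulr_natl (_ * Rm)).
have h (x y : R) : x * (x * (x ^+ 2 * y)) = x ^+ 4 * y by ring.
by rewrite h.
Qed.

(** * Lower bound for the Selberg sum *)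

Lemma squarefree_square_decomp (R : numDomainType) (m : nat) : (0 < m)%N ->
  exists r j, m = (r * j ^ 2)%N /\ mobius R r ^+ 2 = 1.
Proof.
elim/ltn_ind: m => m IH m0.
case: (boolP (all (fun p => logn p m == 1%N) (primes m))) => [hs|].
  exists m, 1%N; split; first by rewrite exp1n muln1.
  by rewrite -mobius_sqr_abs /mobius m0 hs /= normrX normrN1 expr1n.
case/allPn => p pm lp.
have [p_pr _ pd] : [/\ prime p, (0 < m)%N & p %| m] by apply/and3P; rewrite -mem_primes.
have l2 : (1 < logn p m)%N.
  by have : (0 < logn p m)%N; [rewrite logn_gt0 | case: (logn p m) lp => [|[]]].
have : p ^ 2 %| m by rewrite pfactor_dvdn.
case/dvdnP => u mE; have p1 := prime_gt1 p_pr.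
have u0 : (0 < u)%N by case: u mE m0 => // ->.
have um : (u < m)%N by rewrite mE; nia.
have [r [j [uE hr]]] := IH u um u0.
by exists r, (j * p)%N; split => //; rewrite mE uE expnMn; ring.
Qed.

Lemma sum_inv_sqr_le2 (R : realFieldType) n :
  \sum_(j < n.+1) (j%:R ^+ 2)^-1 <= 2 :> R.
Proof.
case: n => [|n]; first by rewrite big_ord1 expr0n invr0; lra.
(* The sharper bound telescopes through [1 / (x + 1) ^ 2 <= 1 / (x * (x + 1))]; the term [j = 0] is
   the inverse of 0, which is 0. *)
suff : \sum_(j < n.+2) (j%:R ^+ 2)^-1 <= 2 - (n.+1%:R)^-1 :> R.
  by move/le_trans; apply; rewrite gerBl invr_ge0 ler0n.
elim: n => [|n IH]; first by rewrite big_ord_recl big_ord1 /= expr0n invr0 expr1n invr1; lra.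
rewrite big_ord_recr /=; apply: le_trans (lerD IH (lexx _)) _.
have n0 : 0 < n.+1%:R :> R by rewrite ltr0n.
rewrite -[n.+2%:R]natr1; move: n0; move: (n.+1%:R : R) => x n0.
have -> : 2 - (x + 1)^-1 = 2 - x^-1 + (x * (x + 1))^-1.
  by field; apply/andP; split; apply/eqP; lra.
rewrite lerD2l lef_pV2 ?posrE; nra.
Qed.

(** With [m = r * j ^ 2] and [r] squarefree, [1 / m] splits as [(1 / r) * (1 / j ^ 2)]; each [r]
    meets every [j] at most once, and the sum over [j] is at most 2. *)
Lemma sum_inv_le_selberg (R : realFieldType) z :
  \sum_(m < z.+1) (m%:R)^-1 <= 2 * selberg_sum R z.
Proof.
pose t (m r j : nat) : R :=
  if m == (r * j ^ 2)%N then mobius R r ^+ 2 / r%:R / j%:R ^+ 2 else 0.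
apply: (@le_trans _ _ (\sum_(m < z.+1) \sum_(r < z.+1) \sum_(j < z.+1) t m r j)).
  apply: ler_sum => m _.
  have t0 m' r j : 0 <= t m' r j.
    by rewrite /t; case: ifP => // _; rewrite !divr_ge0 ?sqr_ge0 ?ler0n.
  case: (posnP m) => [->|m0]; first by rewrite invr0; apply: sumr_ge0 => ? _; apply: sumr_ge0.
  have [r [j [mE hr]]] := squarefree_square_decomp R m0.
  have mz := ltn_ord m.
  have /andP[r0 j0] : (0 < r)%N && (0 < j)%N.
    by move: m0; rewrite mE muln_gt0 expn_gt0 orbF.
  have rz : (r < z.+1)%N by apply: leq_ltn_trans mz; rewrite mE leq_pmulr // expn_gt0 j0.
  have jz : (j < z.+1)%N.
    by apply: leq_ltn_trans mz; rewrite mE -[leqLHS]mul1n leq_mul // -{1}[j]expn1 leq_pexp2l.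
  rewrite (bigD1 (Ordinal rz)) //= (bigD1 (Ordinal jz)) //= {1}/t mE eqxx hr -mE.
  rewrite -addrA mE natrM natrX invfM mul1r lerDl -mE.
  by rewrite addr_ge0 // ?sumr_ge0 // => ? _; rewrite ?sumr_ge0.
rewrite exchange_big /=; under eq_bigr => r _ do rewrite exchange_big /=.
apply: (@le_trans _ _ (\sum_(r < z.+1) mobius R r ^+ 2 / r%:R * 2)); last first.
  by rewrite -mulr_suml mulrC.
apply: ler_sum => r _.
apply: (@le_trans _ _ (\sum_(j < z.+1) mobius R r ^+ 2 / r%:R * (j%:R ^+ 2)^-1)); last first.
  by rewrite -mulr_sumr ler_wpM2l ?sum_inv_sqr_le2 // divr_ge0 ?sqr_ge0 ?ler0n.
apply: ler_sum => j _; rewrite /t -big_mkcond /=.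
have t0 : 0 <= mobius R r ^+ 2 / r%:R / j%:R ^+ 2.
  by rewrite !divr_ge0 ?sqr_ge0 ?ler0n.
case: (ltnP (r * j ^ 2) z.+1) => h; last first.
  by rewrite big_pred0 // => m; apply/negP => /eqP mE; have := ltn_ord m; rewrite mE ltnNge h.
by rewrite (big_pred1 (Ordinal h)).
Qed.

Lemma sum_inv_le_ln (R : realType) (a b : nat) : (0 < a <= b)%N ->
  \sum_(a.+1 <= d < b.+1) (d%:R)^-1 <= ln (b%:R) - ln (a%:R) :> R.
Proof.
case/andP=> a0; elim: b => [|b IH]; first by rewrite leqNgt a0.
rewrite leq_eqVlt => /orP[/eqP ->|]; first by rewrite big_geq // subrr.
rewrite ltnS => ab; rewrite big_nat_recr //=; apply: le_trans (lerD (IH ab) (lexx _)) _.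
have b0 : 0 < b%:R :> R by rewrite ltr0n (leq_trans a0).
have b1 : 0 < b.+1%:R :> R by rewrite ltr0n.
(* [ln (1 + x) <= x] at [x = - 1 / (b + 1)] bounds [1 / (b + 1)] by [ln (b + 1) - ln b]. *)
have h : -1 < - (b.+1%:R)^-1 :> R.
  by rewrite ltrN2 invf_lt1 ?ltr1n // ltnS (leq_trans a0).
have := le_ln1Dx h.
have -> : 1 - (b.+1%:R)^-1 = b%:R / b.+1%:R :> R.
  by rewrite -natr1; field; rewrite natr1 gt_eqF.
by rewrite ln_div ?posrE // => h2; clear -h2; move: h2; move: (ln _) (ln _) (ln _) (_^-1) => u v w x; lra.
Qed.

Lemma sum_inv_ge_ln (R : realType) (a b : nat) : (a <= b)%N ->
  ln (b.+1%:R) - ln (a.+1%:R) <= \sum_(a.+1 <= d < b.+1) (d%:R)^-1 :> R.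
Proof.
elim: b => [|b IH]; first by rewrite leqn0 => /eqP ->; rewrite big_geq // subrr.
rewrite leq_eqVlt => /orP[/eqP ->|]; first by rewrite big_geq // subrr.
rewrite ltnS => ab; rewrite big_nat_recr //=; have := lerD (IH ab) (lexx (b.+1%:R)^-1).
apply: le_trans.
have b1 : 0 < b.+1%:R :> R by rewrite ltr0n.
have b2 : 0 < b.+2%:R :> R by rewrite ltr0n.
have h : -1 < (b.+1%:R)^-1 :> R by rewrite (@lt_le_trans _ _ 0) ?invr_ge0 ?ltW ?ltrN10.
have := le_ln1Dx h.
have -> : 1 + (b.+1%:R)^-1 = b.+2%:R / b.+1%:R :> R.
  by rewrite -[b.+2%:R]natr1 mulrDl mul1r divff ?gt_eqF.
by rewrite ln_div ?posrE // => h2; clear -h2; move: h2; move: (ln _) (ln _) (ln _) (_^-1) => u v w x; lra.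
Qed.

Lemma ln_le_selberg_sum (R : realType) z : (0 < z)%N -> ln (z%:R) <= 2 * selberg_sum R z.
Proof.
move=> z0; apply: le_trans (sum_inv_le_selberg R z).
rewrite big_ord_recl invr0 add0r.
have := sum_inv_ge_ln R (leq0n z); rewrite ln1 subr0 big_add1 big_mkord; apply: le_trans.
by rewrite ler_ln ?posrE ?ltr0n // ler_nat.
Qed.

(** * Fractional parts of y / d near the square root *)

(** Dirichlet's bound [|q * y / D - a| <= 1 / Q] with denominators cleared. Two of the [Q + 1]
    fractional parts of [j * y / D] fall into the same of [Q] boxes of length [1 / Q]. *)
Lemma dirichlet_approx (y D Q : nat) : (0 < D)%N -> (0 < Q)%N ->
  exists q a, [/\ (0 < q <= Q)%N, coprime a q,
    (q * y * Q <= a * D * Q + D)%N & (a * D * Q <= q * y * Q + D)%N].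
Proof.
move=> D0 Q0.
have fP (j : 'I_Q.+1) : ((j * y) %% D * Q %/ D < Q)%N.
  by rewrite ltn_divLR // [ltnRHS]mulnC ltn_pmul2r // ltn_pmod.
pose f j : 'I_Q := Ordinal (fP j).
have [j [j' [jj' fj]]] : exists j j' : 'I_Q.+1, (j < j')%N /\ f j = f j'.
  have /injectivePn[j [j' jj' fj]] : ~~ injectiveb f.
    by apply/negP => /injectiveP/leq_card; rewrite !card_ord ltnn.
  case: (ltngtP j j') => h; [by exists j, j'|by exists j', j|].
  by rewrite (val_inj h) eqxx in jj'.
have /= := congr1 val fj; set b := (_ %/ D)%N => bE.
have b1 := divn_eq ((j * y) %% D * Q) D; have b2 := divn_eq ((j' * y) %% D * Q) D.
have b3 := ltn_pmod ((j * y) %% D * Q) D0; have b4 := ltn_pmod ((j' * y) %% D * Q) D0.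
have e1 := divn_eq (j * y) D; have e2 := divn_eq (j' * y) D.
have uu : (j * y %/ D <= j' * y %/ D)%N by rewrite leq_div2r // leq_mul2r ltnW ?orbT.
rewrite -/b in b1; rewrite -bE in b2.
move: b1 b2 b3 b4 e1 e2 uu.
move: (_ %% D * Q %% D)%N (_ %% D * Q %% D)%N => s s'.
move: ((j * y) %% D)%N ((j' * y) %% D)%N => r r'.
(* The differences [q0], [a0] need not be coprime; dividing both by their gcd [g] also divides the
   error by [g]. *)
move: (_ %/ D)%N (_ %/ D)%N => u' u b1 b2 b3 b4 e1 e2 uu.
pose q0 := (j' - j)%N; pose a0 := (u' - u)%N; pose g := gcdn a0 q0.
have q0_gt0 : (0 < q0)%N by rewrite subn_gt0.
have g0 : (0 < g)%N by rewrite gcdn_gt0 q0_gt0 orbT.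
have eq0 : (q0 * y * Q + r * Q = a0 * D * Q + r' * Q)%N.
  rewrite -!mulnDl; congr (_ * Q)%N.
  by rewrite /q0 /a0 mulnBl mulnBl; have := leq_mul uu (leqnn D); have := leq_mul (ltnW jj') (leqnn y); lia.
have [q qE] : exists q, q0 = (q * g)%N by apply/dvdnP; rewrite dvdn_gcdr.
have [a aE] : exists a, a0 = (a * g)%N by apply/dvdnP; rewrite dvdn_gcdl.
exists q, a; split.
- have : (q0 <= Q)%N by rewrite /q0; have := ltn_ord j'; lia.
  by move: q0_gt0; rewrite qE muln_gt0 => /andP[-> _] /=; apply: leq_trans; rewrite leq_pmulr.
- have : (gcdn a q * g = g)%N by rewrite muln_gcdl -qE -aE.
  by move/eqP; rewrite -[eqbRHS]mul1n eqn_pmul2r // /coprime.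
- have : (q0 * y * Q <= a0 * D * Q + D)%N by lia.
  have -> : (q0 * y * Q = q * y * Q * g)%N by rewrite qE; ring.
  have -> : (a0 * D * Q = a * D * Q * g)%N by rewrite aE; ring.
  by move=> h; rewrite -(leq_pmul2r g0) mulnDl; apply: leq_trans h _; rewrite leq_add2l leq_pmulr.
- have : (a0 * D * Q <= q0 * y * Q + D)%N by lia.
  have -> : (q0 * y * Q = q * y * Q * g)%N by rewrite qE; ring.
  have -> : (a0 * D * Q = a * D * Q * g)%N by rewrite aE; ring.
  by move=> h; rewrite -(leq_pmul2r g0) mulnDl; apply: leq_trans h _; rewrite leq_add2l leq_pmulr.
Qed.

Lemma sum_natr_ord (R : realFieldType) (q : nat) :
  \sum_(h < q) h%:R = q%:R * (q%:R - 1) / 2 :> R.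
Proof.
elim: q => [|q IH]; first by rewrite big_ord0 !mul0r.
by rewrite big_ord_recr /= IH -natr1; field.
Qed.

(* As [h] runs over a complete residue system, so does [B + a * h], hence the
   remainders contribute [0 + ... + (q - 1)]. *)
Lemma sum_divn_linear (R : realFieldType) (q a B : nat) : (0 < q)%N -> coprime a q ->
  \sum_(h < q) ((B + a * h) %/ q)%:R = B%:R + (a%:R - 1) * (q%:R - 1) / 2 :> R.
Proof.
move=> q0 aq.
have modq : \sum_(h < q) ((B + a * h) %% q)%:R = q%:R * (q%:R - 1) / 2 :> R.
  rewrite -sum_natr_ord; pose f (h : 'I_q) : 'I_q := Ordinal (ltn_pmod (B + a * h) q0).
  suff f_inj : injective f by rewrite [RHS](reindex_inj f_inj).
  move=> h1 h2 /(congr1 val) /= /eqP.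
  wlog h12 : h1 h2 / (h1 <= h2)%N => [W|].
    case: (leqP h1 h2) => [/W|/ltnW /W h] //; rewrite eq_sym => /h -> //.
  rewrite eqn_modDl eq_sym eqn_mod_dvd ?leq_mul2l ?h12 ?orbT // -mulnBr Gauss_dvdr 1?coprime_sym //.
  move=> /dvdn_leq h; apply/val_inj => /=.
  case: (posnP (h2 - h1)) => [|/h]; first lia.
  by have := ltn_ord h2; lia.
have qR : 0 < q%:R :> R by rewrite ltr0n.
have : q%:R * \sum_(h < q) ((B + a * h) %/ q)%:R + \sum_(h < q) ((B + a * h) %% q)%:R =
    \sum_(h < q) (B%:R + a%:R * h%:R) :> R.
  rewrite mulr_sumr -big_split; apply: eq_bigr => h _ /=.
  by rewrite -!natrM -!natrD mulnC -divn_eq.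
rewrite modq big_split /= sumr_const card_ord -mulr_sumr sum_natr_ord -mulr_natl => e.
by apply: (mulfI (lt0r_neq0 qR)); move: e; move: (\sum_(_ < _) _) => S e; lra.
Qed.

(** First-order expansion of [q * y / (D - h)]: the linear term [T] is within 1 of [a * h] by the
    rational approximation and [h <= Q], and the remainder [E] lies in [[0, 1]] by the bound on the
    curvature. *)
Lemma hyperbola_tangent_error (R : realFieldType) (y D q a Q h : R) :
  0 <= y -> 0 < D -> 0 < q -> 0 < Q -> 0 <= h <= Q -> 2 * h <= D ->
  2 * q * y * h ^+ 2 <= D ^+ 3 ->
  q * y * Q <= a * D ^+ 2 * Q + D ^+ 2 -> a * D ^+ 2 * Q <= q * y * Q + D ^+ 2 ->
  q * y / D + a * h - 1 <= q * (y / (D - h)) <= q * y / D + a * h + 2.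
Proof.
move=> y0 D0 q0 Q0 /andP[h0 hQ] hD quad ub lb.
have Dh : 0 < D - h by lra.
set T := q * y * h / D ^+ 2; set E := q * y * h ^+ 2 / (D ^+ 2 * (D - h)).
have -> : q * (y / (D - h)) = q * y / D + T + E.
  by rewrite /T /E; field; rewrite !gt_eqF.
have D2 : 0 < D ^+ 2 by rewrite exprn_gt0.
have E0 : 0 <= E by rewrite /E divr_ge0 ?mulr_ge0 ?sqr_ge0 // ltW.
have E1 : E <= 1.
  rewrite /E ler_pdivrMr ?mulr_gt0 // mul1r.
  have : D ^+ 2 * D <= D ^+ 2 * (2 * (D - h)) by rewrite ler_pM2l //; lra.
  by move: quad; rewrite exprSr; lra.
have T1 : T - a * h <= 1.
  have -> : T - a * h = h * (q * y - a * D ^+ 2) / D ^+ 2 by rewrite /T; field; rewrite gt_eqF.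
  rewrite ler_pdivrMr // mul1r; case: (leP (q * y - a * D ^+ 2) 0) => s; first by nra.
  have : h * (q * y - a * D ^+ 2) <= Q * (q * y - a * D ^+ 2) by rewrite ler_pM2r.
  by lra.
have T2 : -1 <= T - a * h.
  have -> : T - a * h = h * (q * y - a * D ^+ 2) / D ^+ 2 by rewrite /T; field; rewrite gt_eqF.
  rewrite ler_pdivlMr // mulN1r; case: (leP 0 (q * y - a * D ^+ 2)) => s; first by nra.
  have : h * (a * D ^+ 2 - q * y) <= Q * (a * D ^+ 2 - q * y) by rewrite ler_pM2r //; lra.
  by lra.
by apply/andP; split; lra.
Qed.

Definition saw (R : realFieldType) (y d : nat) : R := y%:R / d%:R - (y %/ d)%:R - 2^-1.

Lemma divn_natr_bounds (R : realFieldType) (y d : nat) : (0 < d)%N ->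
  (y %/ d)%:R <= (y%:R / d%:R : R) < (y %/ d)%:R + 1.
Proof.
move=> d0; have dR : 0 < d%:R :> R by rewrite ltr0n.
rewrite ler_pdivlMr // ltr_pdivrMr // -natrM ler_nat leq_divM natr1 -natrM ltr_nat.
by rewrite ltn_ceil.
Qed.

Lemma saw_abs (R : realFieldType) (y d : nat) : (0 < d)%N -> `|saw R y d| <= 1.
Proof.
move=> d0; have /andP[h1 h2] := divn_natr_bounds R y d0.
by rewrite /saw ler_norml; apply/andP; split; lra.
Qed.

(* On the run, [y / (D - h)] is within [O(1 / q)] of [y / D + a * h / q], whose
   integer parts have an explicit sum. *)
Lemma saw_run (R : realFieldType) (y D q a Q : nat) :
  (0 < q <= Q)%N -> coprime a q -> (2 * Q <= D)%N -> (D <= y)%N -> (2 * y * Q ^ 3 <= D ^ 3)%N ->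
  (q * y * Q <= a * D ^ 2 * Q + D ^ 2)%N -> (a * D ^ 2 * Q <= q * y * Q + D ^ 2)%N ->
  `|\sum_(h < q) saw R y (D - h)| <= 4.
Proof.
move=> /andP[q0 qQ] aq QD Dy quad ub lb.
have D0 : (0 < D)%N by lia.
pose A := (q * y %/ D)%N.
have A0 : (0 < A)%N by rewrite divn_gt0 // (leq_trans Dy) // leq_pmull.
have /andP[A1 A2] := divn_natr_bounds R (q * y) D0; rewrite -/A natrM in A1 A2.
have beta (h : 'I_q) : q%:R * y%:R / D%:R + a%:R * h%:R - 1 <= (q%:R * (y%:R / (D - h)%:R) : R)
    <= q%:R * y%:R / D%:R + a%:R * h%:R + 2.
  have hq := ltn_ord h; rewrite natrB; last lia.
  apply: (@hyperbola_tangent_error R _ _ _ _ Q%:R); rewrite ?ler0n ?ltr0n //; first lia.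
  - by rewrite ler_nat; lia.
  - by rewrite -natrM ler_nat; lia.
  - rewrite -!natrX -!natrM ler_nat; apply: leq_trans quad.
    have -> : (2 * y * Q ^ 3 = 2 * Q * y * Q ^ 2)%N by ring.
    by apply: leq_mul; [rewrite leq_mul2r leq_mul2l qQ !orbT | rewrite leq_sqr; lia].
  - by rewrite -!natrX -!natrM -!natrD ler_nat.
  - by rewrite -!natrX -!natrM -!natrD ler_nat.
have qR : 0 < q%:R :> R by rewrite ltr0n.
(* Since [A <= q * y / D < A + 1], the deviations [+2] and [-1] in [beta] let the integer parts be
   compared with the linear ones started at [A + 2] and at [A.-1]; [A > 0] makes the latter a true
   predecessor. *)
have floor_ub (h : 'I_q) : (y %/ (D - h) <= (A + 2 + a * h) %/ q)%N.
  have Dh : (0 < D - h)%N by have := ltn_ord h; lia.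
  have /andP[f1 f2] := divn_natr_bounds R y Dh; have /andP[b1 b2] := beta h.
  rewrite leq_divRL // -ltnS -(ltr_nat R) -natr1 !natrD !natrM.
  have := ler_wpM2l (ltW qR) f1; rewrite [_ * q%:R]mulrC.
  by lra.
have floor_lb (h : 'I_q) : ((A.-1 + a * h) %/ q <= y %/ (D - h))%N.
  have Dh : (0 < D - h)%N by have := ltn_ord h; lia.
  have /andP[f1 f2] := divn_natr_bounds R y Dh; have /andP[b1 b2] := beta h.
  rewrite -ltnS ltn_divLR // -(ltr_nat R) natrM natrD natrM -natr1.
  have -> : A.-1%:R = A%:R - 1 :> R by rewrite -{2}(prednK A0) -natr1 addrK.
  have : q%:R * (y%:R / (D - h)%:R) < q%:R * ((y %/ (D - h))%:R + 1) :> R by rewrite ltr_pM2l.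
  by rewrite [_ * q%:R]mulrC; lra.
have sF1 : \sum_(h < q) (y %/ (D - h))%:R <= (A + 2)%:R + (a%:R - 1) * (q%:R - 1) / 2 :> R.
  by rewrite -sum_divn_linear //; apply: ler_sum => h _; rewrite ler_nat.
have sF2 : A.-1%:R + (a%:R - 1) * (q%:R - 1) / 2 <= \sum_(h < q) (y %/ (D - h))%:R :> R.
  by rewrite -sum_divn_linear //; apply: ler_sum => h _; rewrite ler_nat.
have -> : \sum_(h < q) saw R y (D - h) =
    \sum_(h < q) y%:R / (D - h)%:R - \sum_(h < q) (y %/ (D - h))%:R - q%:R / 2.
  rewrite /saw !sumrB; congr (_ - _).
  by rewrite sumr_const card_ord mulr_natl.
have lin (c : R) : \sum_(h < q) (q%:R * y%:R / D%:R + a%:R * h%:R + c) =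
    q%:R * (q%:R * y%:R / D%:R + a%:R * (q%:R - 1) / 2 + c).
  rewrite big_split big_split /= !sumr_const card_ord -mulr_sumr sum_natr_ord.
  rewrite -[X in _ + X]mulr_natl -[X in X + _ + _]mulr_natl; field.
  by rewrite pnatr_eq0 -lt0n.
have sB1 : \sum_(h < q) y%:R / (D - h)%:R <= q%:R * y%:R / D%:R + a%:R * (q%:R - 1) / 2 + 2 :> R.
  rewrite -(ler_pM2l qR) -lin mulr_sumr; apply: ler_sum => h _; by case/andP: (beta h).
have sB2 : q%:R * y%:R / D%:R + a%:R * (q%:R - 1) / 2 - 1 <= \sum_(h < q) y%:R / (D - h)%:R :> R.
  rewrite -(ler_pM2l qR) -lin mulr_sumr; apply: ler_sum => h _; by case/andP: (beta h).
have Ap : A.-1%:R = A%:R - 1 :> R by rewrite -{2}(prednK A0) -natr1 addrK.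
rewrite natrD in sF1; rewrite Ap in sF2.
(* The terms in [a] cancel and [(q - 1) / 2 - q / 2 = - 1 / 2], so the sum is within [7 / 2] of
   0. *)
by rewrite ler_norml; apply/andP; split; lra.
Qed.

(** For [d > 0] this is [|y / d ^ 2 - a / q| <= 1 / (q * Q)] with denominators cleared, the form
    produced by [dirichlet_approx] at [D = d ^ 2]. *)
Definition slope_near (y Q q a d : nat) : bool :=
  [&& (0 < q)%N, (q * y * Q <= a * d ^ 2 * Q + d ^ 2)%N & (a * d ^ 2 * Q <= q * y * Q + d ^ 2)%N].

(* The slope [y / d ^ 2] of the hyperbola is near a fraction of denominator less
   than [Q0]: a run ending at [d] may then be too short to be useful. *)
Definition major_slope (y Q Q0 M d : nat) : bool :=
  [exists q : 'I_Q0, exists a : 'I_M, slope_near y Q q a d].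

Lemma sum_window_le (P : pred nat) (a b W : nat) :
  (forall d1 d2, (a <= d1)%N -> (d1 <= d2)%N -> (d2 < b)%N -> P d1 -> P d2 -> (d2 - d1 <= W)%N) ->
  (\sum_(a <= d < b) P d <= W.+1)%N.
Proof.
move=> hP; set s := [seq d <- index_iota a b | P d].
have -> : (\sum_(a <= d < b) P d = size s)%N.
  rewrite size_filter -sum1_count [RHS]big_mkcond.
  by apply: eq_bigr => d _; case: (P d).
case: (boolP (has P (index_iota a b))) => [|]; last by rewrite has_filter negbK -/s => /eqP ->.
move/hasP => [d0 d0s Pd0].
have ex : exists d, (a <= d)%N && (d < b)%N && P d by exists d0; rewrite Pd0 andbT -mem_index_iota.
have [m /andP[/andP[am mb] Pm] m_min] := ex_minnP ex.
rewrite -(size_iota m W.+1); apply: uniq_leq_size; first by rewrite filter_uniq ?iota_uniq.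
move=> d; rewrite mem_filter mem_index_iota mem_iota => /andP[Pd /andP[ad db]].
have md : (m <= d)%N by apply: m_min; rewrite ad db.
by rewrite md /= addnS ltnS -leq_subLR; apply: hP.
Qed.

(* Two points with slopes near the same [a / q] satisfy
   [(a Q - 1) d2 ^ 2 <= q y Q <= (a Q + 1) d1 ^ 2]. *)
Lemma slope_near_window (y Q q a d1 d2 D' : nat) :
  (1 < Q)%N -> (D' ^ 2 < y * Q)%N -> (d1 <= d2 <= D')%N ->
  slope_near y Q q a d1 -> slope_near y Q q a d2 -> (d2 - d1 <= 2 * D' %/ Q)%N.
Proof.
move=> Q1 D'y /andP[d12 d2D] /and3P[q0 u1 l1] /and3P[_ u2 l2].
rewrite leq_divRL; last lia.
(* [a = 0] would give [q * y * Q <= d1 ^ 2 <= D' ^ 2 < y * Q]. *)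
have a0 : (0 < a)%N.
  rewrite lt0n; apply/eqP => a0; move: u1; rewrite a0 mul0n mul0n add0n leqNgt.
  have : (d1 ^ 2 <= D' ^ 2)%N by rewrite leq_sqr (leq_trans d12).
  move=> h; apply/negP; rewrite negbK; apply: leq_ltn_trans h _.
  by apply: leq_trans D'y _; rewrite -mulnA leq_pmull.
have [e dE] : exists e, d2 = (d1 + e)%N by exists (d2 - d1)%N; lia.
rewrite dE addKn.
case: (posnP d1) => [d10|d10].
  by move: u1; rewrite d10 exp0n // muln0 mul0n leqn0 !muln_eq0 => /orP[/orP[]|] /eqP; nia.
have : (a * d2 ^ 2 * Q <= a * d1 ^ 2 * Q + d1 ^ 2 + d2 ^ 2)%N by lia.
rewrite dE => h.
have h1 : (a * Q * (2 * d1 * e + e * e) <= 2 * (d1 * d1) + 2 * d1 * e + e * e)%N.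
  by move: h; rewrite -!mulnn; nia.
have aQ : (2 <= a * Q)%N by nia.
(* As [a * Q >= 2], half of the left side of [h1] absorbs the terms [2 * d1 * e + e * e] on its
   right. *)
have h2 : (a * Q * e <= 2 * d1)%N.
  rewrite -(leq_pmul2l d10).
  have : (2 * (2 * d1 * e + e * e) <= a * Q * (2 * d1 * e + e * e))%N by rewrite leq_mul2r aQ orbT.
  move: h1; set X := (a * Q)%N => h1 h3.
  have e1 : (X * (2 * d1 * e + e * e) = 2 * (d1 * (X * e)) + X * (e * e))%N by ring.
  have : (2 * (e * e) <= X * (e * e))%N by rewrite leq_mul2r aQ orbT.
  by lia.
have : (e * Q <= a * Q * e)%N by nia.
have : (d1 <= D')%N by lia.
by lia.
Qed.

(** Union bound over the fractions [a / q]: the points near one of them lie in a window of length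
    [2 * D' %/ Q]. *)
Lemma sum_major_slope_le (y Q Q0 M D D' : nat) :
  (1 < Q)%N -> (D' ^ 2 < y * Q)%N ->
  (\sum_(D.+1 <= d < D'.+1) major_slope y Q Q0 M d <= Q0 * (M * (2 * D' %/ Q).+1))%N.
Proof.
move=> Q1 D'y.
apply: (@leq_trans (\sum_(D.+1 <= d < D'.+1) \sum_(q < Q0) \sum_(a < M) slope_near y Q q a d)%N).
  apply: leq_sum => d _; case: (boolP (major_slope _ _ _ _ _)) => // /existsP[q /existsP[a qa]].
  by rewrite (bigD1 q) //= (bigD1 a) //= qa.
rewrite exchange_big /=; rewrite -[X in (_ <= X * _)%N](card_ord Q0) -sum_nat_const.
apply: leq_sum => q _.
rewrite exchange_big /=; rewrite -[X in (_ <= X * _)%N](card_ord M) -sum_nat_const.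
apply: leq_sum => a _; apply: sum_window_le => d1 d2 _ d12 d2D h1 h2.
by apply: slope_near_window D'y _ h1 h2 => //; rewrite d12.
Qed.

(* Runs given by [dirichlet_approx] are removed one by one from the right end. *)
Lemma saw_sum_le_major (R : realFieldType) (y Q Q0 M D D' D1 : nat) :
  (0 < Q0)%N -> (0 < Q)%N -> (2 * Q <= D)%N -> (D' <= y)%N -> (2 * y * Q ^ 3 <= D ^ 3)%N ->
  (Q0 * y <= M * D ^ 2)%N -> (D <= D1 <= D')%N ->
  `|\sum_(D.+1 <= d < D1.+1) saw R y d| <=
    4 * (D1 - D)%:R / Q0%:R + 4 * (\sum_(D.+1 <= d < D1.+1) major_slope y Q Q0 M.+2 d)%:R + Q%:R.
Proof.
move=> Q00 Q10 QD D'y quad MD.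
have Q0R : 0 < Q0%:R :> R by rewrite ltr0n.
elim/ltn_ind: D1 => D1 IH /andP[DD1 D1D'].
(* A final stretch of length at most [Q] is estimated trivially, giving the term [Q]; otherwise a
   run of length [q <= Q] fits inside. *)
case: (leqP (D1 - D) Q) => [short|long].
  apply: le_trans (ler_norm_sum _ _ _) _.
  apply: (@le_trans _ _ Q%:R); last first.
    by rewrite lerDr addr_ge0 // ?mulr_ge0 ?divr_ge0 ?mulr_ge0 ?ler0n ?invr_ge0.
  apply: (@le_trans _ _ (\sum_(D.+1 <= d < D1.+1) 1)); last first.
    by rewrite sumr_const_nat -[1]/(1%:R) -mulrnA mul1n ler_nat subSS.
  by rewrite !big_nat; apply: ler_sum => d /andP[dD _]; apply: saw_abs; lia.
have D10 : (0 < D1 ^ 2)%N by rewrite expn_gt0; lia.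
have [q [a [qQ aq ub lb]]] := dirichlet_approx y D10 Q10.
have /andP[q0 qleQ] := qQ.
have run : `|\sum_(h < q) saw R y (D1 - h)| <= 4.
  apply: (@saw_run R y D1 q a Q) => //; [lia|lia|].
  by apply: leq_trans quad _; rewrite leq_exp2r.
pose D2 := (D1 - q)%N.
have D2D : (D <= D2)%N by rewrite /D2; lia.
have D2D1 : (D2 < D1)%N by rewrite /D2; lia.
have D2r : (D <= D2 <= D')%N by rewrite D2D; lia.
have := IH D2 D2D1 D2r.
have cut (T : nmodType) (F : nat -> T) : \sum_(D.+1 <= d < D1.+1) F d =
    \sum_(D.+1 <= d < D2.+1) F d + \sum_(D2.+1 <= d < D1.+1) F d.
  by rewrite (@big_cat_nat _ _ _ D2.+1) //; lia.
rewrite cut.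
have -> : \sum_(D2.+1 <= d < D1.+1) saw R y d = \sum_(h < q) saw R y (D1 - h).
  rewrite big_nat_rev /= -{1}[D2.+1]add0n big_addn big_mkord.
  have -> : (D1.+1 - D2.+1 = q)%N by rewrite /D2; lia.
  by apply: eq_bigr => h _; congr saw; rewrite /D2; have := ltn_ord h; lia.
have -> : (\sum_(D.+1 <= d < D1.+1) major_slope y Q Q0 M.+2 d)%N =
    (\sum_(D.+1 <= d < D2.+1) major_slope y Q Q0 M.+2 d +
     \sum_(D2.+1 <= d < D1.+1) major_slope y Q Q0 M.+2 d)%N.
  by rewrite (@big_cat_nat _ _ _ D2.+1) //; lia.
have D1E : (D1 - D)%:R = (D2 - D)%:R + q%:R :> R by rewrite -natrD; congr _%:R; rewrite /D2; lia.
(* The cost 4 of a run is charged to its length when [q >= Q0], and otherwise to its right end [D1],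
   which is then a point of major slope. *)
have gain : 1 <= q%:R / Q0%:R + (\sum_(D2.+1 <= d < D1.+1) major_slope y Q Q0 M.+2 d)%:R :> R.
  case: (leqP Q0 q) => [h|h].
    by rewrite -[leLHS]addr0 lerD ?ler0n // ler_pdivlMr // mul1r ler_nat.
  rewrite -[leLHS]add0r lerD ?divr_ge0 ?ler0n // ler1n.
  rewrite big_nat_recr //=; apply: (leq_trans _ (leq_addl _ _)); rewrite lt0b.
  (* [q * y <= M * D1 ^ 2], and the approximation error adds at most 1, so [a <= M + 1]. *)
  have aM : (a < M.+2)%N.
    have h1 : (q * y <= M * D1 ^ 2)%N.
      apply: (@leq_trans (Q0 * y)%N); first by rewrite leq_mul2r (ltnW h) orbT.
      by apply: leq_trans MD _; rewrite leq_mul2l leq_sqr DD1 orbT.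
    have h2 : (q * y * Q <= M * D1 ^ 2 * Q)%N by rewrite leq_mul2r h1 orbT.
    rewrite ltnNge; apply/negP => h3.
    have h4 : (M.+2 * (D1 ^ 2 * Q) <= a * (D1 ^ 2 * Q))%N by rewrite leq_mul2r h3 orbT.
    have h5 : (D1 ^ 2 <= D1 ^ 2 * Q)%N by rewrite leq_pmulr.
    have h6 : (D1 ^ 2 + M * D1 ^ 2 * Q < M.+2 * (D1 ^ 2 * Q))%N.
      by rewrite !mulSn mulnA addnA; move: h5 D10; move: (D1 ^ 2 * Q)%N (M * D1 ^ 2 * Q)%N; lia.
    by move: lb; rewrite -mulnA; lia.
  apply/existsP; exists (Ordinal h); apply/existsP; exists (Ordinal aM).
  by rewrite /slope_near /= q0 ub lb.
rewrite natrD D1E => IHs; apply: le_trans (ler_normD _ _) _.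
move: IHs run gain; rewrite [4 * (_ + q%:R)]mulrDr mulrDl -[4 * q%:R / _]mulrA.
by lra.
Qed.

Lemma saw_sum_le (R : realFieldType) (y Q Q0 M D D' : nat) :
  (0 < Q0)%N -> (1 < Q)%N -> (2 * Q <= D)%N -> (D <= D' <= y)%N -> (2 * y * Q ^ 3 <= D ^ 3)%N ->
  (Q0 * y <= M * D ^ 2)%N -> (D' ^ 2 < y * Q)%N ->
  `|\sum_(D.+1 <= d < D'.+1) saw R y d| <=
    4 * D'%:R / Q0%:R + 4 * (Q0 * (M.+2 * (2 * D' %/ Q).+1))%:R + Q%:R.
Proof.
move=> Q00 Q1 QD /andP[DD' D'y] quad MD D'2.
apply: le_trans (saw_sum_le_major R Q00 (ltnW Q1) QD D'y quad MD _) _; first by rewrite DD' leqnn.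
rewrite lerD2r lerD //.
  by rewrite ler_wpM2r ?invr_ge0 ?ler0n // ler_wpM2l // ler_nat leq_subr.
by rewrite ler_wpM2l // ler_nat sum_major_slope_le.
Qed.

(** * Multiples in a short interval *)

Lemma sum_dvd_reindex (V : nmodType) (e a b : nat) (F : nat -> V) :
  (0 < e)%N -> (a <= b)%N ->
  \sum_(a.+1 <= d < b.+1 | e %| d) F d = \sum_((a %/ e).+1 <= d < (b %/ e).+1) F (e * d)%N.
Proof.
move=> e0; elim: b => [|b IH]; first by rewrite leqn0 => /eqP ->; rewrite !big_geq.
rewrite leq_eqVlt => /orP[/eqP ->|]; first by rewrite !big_geq.
rewrite ltnS => ab; rewrite big_mkcond big_nat_recr //= -big_mkcond IH // divnS //.
case: (boolP (e %| b.+1)%N) => eb; last by rewrite addr0.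
rewrite add1n [RHS]big_nat_recr; last by rewrite ltnS leq_div2r.
by congr (_ + F _); rewrite -[LHS](divnK eb) divnS // eb mulnC.
Qed.

Lemma sum_divn_diff (R : realFieldType) (y1 y2 a b : nat) : (y1 <= y2)%N ->
  \sum_(a.+1 <= d < b.+1) (y2 %/ d - y1 %/ d)%:R =
  (y2%:R - y1%:R) * \sum_(a.+1 <= d < b.+1) (d%:R)^-1
    - \sum_(a.+1 <= d < b.+1) saw R y2 d + \sum_(a.+1 <= d < b.+1) saw R y1 d.
Proof.
move=> y12; rewrite mulr_sumr -sumrB -big_split; apply: eq_bigr => d _ /=.
by rewrite natrB ?leq_div2r // /saw; ring.
Qed.

(** The logarithms of [k / e] and [D / e] share the term [- ln e], which cancels. Rounding the end
    points costs [O(e / k)], as [k / e >= 2]. *)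
Lemma sum_inv_quotient (R : realType) (e k D : nat) : (0 < e)%N -> (2 * e <= k)%N -> (k <= D)%N ->
  `|\sum_((k %/ e).+1 <= d < (D %/ e).+1) (d%:R)^-1 - (ln D%:R - ln k%:R)| <= 2 * e%:R / k%:R :> R.
Proof.
move=> e0 ek kD.
have eR : 0 < e%:R :> R by rewrite ltr0n.
have kR : 0 < k%:R :> R by rewrite ltr0n; lia.
have DR : 0 < D%:R :> R by rewrite ltr0n; lia.
have a1 : (1 < k %/ e)%N by rewrite leq_divRL.
have ab : (k %/ e <= D %/ e)%N by rewrite leq_div2r.
have aR : 0 < (k %/ e)%:R :> R by rewrite ltr0n; lia.
have bR : 0 < (D %/ e)%:R :> R by rewrite ltr0n; lia.
have b1R : 0 < (D %/ e).+1%:R :> R by rewrite ltr0n.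
have a1R : 0 < (k %/ e).+1%:R :> R by rewrite ltr0n.
have /andP[fa1 fa2] := divn_natr_bounds R k e0.
have /andP[fb1 fb2] := divn_natr_bounds R D e0.
have ln_quot (u v : R) : 0 < u -> 0 < v -> ln u - ln v <= u / v - 1.
  move=> u0 v0; rewrite -ln_div ?posrE //.
  have h : -1 < u / v - 1 by have := divr_gt0 u0 v0; lra.
  by have := le_ln1Dx h; rewrite addrC subrK.
have up := @sum_inv_le_ln R (k %/ e) (D %/ e) (introT andP (conj (ltnW a1) ab)).
have lo := @sum_inv_ge_ln R _ _ ab.
have lD : ln (D%:R / e%:R) = ln D%:R - ln e%:R :> R by rewrite ln_div ?posrE.
have lk : ln (k%:R / e%:R) = ln k%:R - ln e%:R :> R by rewrite ln_div ?posrE.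
have u1 : ln (D %/ e)%:R <= ln (D%:R / e%:R) :> R by rewrite ler_ln ?posrE ?divr_gt0.
have u2 : ln (k%:R / e%:R) - ln (k %/ e)%:R <= 2 * e%:R / k%:R :> R.
  apply: le_trans (ln_quot _ _ (divr_gt0 kR eR) aR) _.
  rewrite -[leRHS](addrK 1) lerD2r ler_pdivrMr //.
  have ke2 : 2 <= k%:R / e%:R :> R by rewrite ler_pdivlMr // -natrM ler_nat.
  have -> : 2 * e%:R / k%:R = 2 / (k%:R / e%:R) :> R by field; rewrite !gt_eqF.
  move: (k%:R / e%:R) fa1 fa2 ke2 => x; move: ((k %/ e)%:R : R) => v v1 v2 x2.
  have x0 : 0 < x by lra.
  have -> : (2 / x + 1) * v = (2 + x) * v / x by field; rewrite gt_eqF.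
  by rewrite ler_pdivlMr //; nra.
have l1 : ln (D%:R / e%:R) <= ln (D %/ e).+1%:R :> R.
  by rewrite ler_ln ?posrE ?divr_gt0 // -natr1 ltW.
have l2 : ln (k %/ e).+1%:R - ln (k%:R / e%:R) <= 2 * e%:R / k%:R :> R.
  apply: le_trans (ln_quot _ _ a1R (divr_gt0 kR eR)) _; rewrite -natr1.
  have -> : 2 * e%:R / k%:R = 2 / (k%:R / e%:R) :> R by field; rewrite !gt_eqF.
  have : 0 < k%:R / e%:R :> R by rewrite divr_gt0.
  move: (k%:R / e%:R) fa1 => x; move: ((k %/ e)%:R : R) => v v1 x0.
  by rewrite lerBlDr ler_pdivrMr // mulrDl divfK ?gt_eqF //; lra.
by rewrite ler_norml; apply/andP; split; lra.
Qed.

(** Put [d = e * d'] and let [L = ln D - ln k]. The difference of the integer parts of [(n + k) / e]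
    and [n / e] is within 1 of [k / e], which costs the harmonic sum, at most [L + 1]; replacing
    that sum by [L] in the main term costs 2, and the two sawtooth sums cost [2 * E]. *)
Lemma sum_multiples_error (R : realType) (n k D e : nat) (E : R) :
  (0 < e)%N -> (2 * e <= k)%N -> (k <= D)%N ->
  `|\sum_((k %/ e).+1 <= d < (D %/ e).+1) saw R (n %/ e) d| <= E ->
  `|\sum_((k %/ e).+1 <= d < (D %/ e).+1) saw R ((n + k) %/ e) d| <= E ->
  `|\sum_(k.+1 <= d < D.+1 | e %| d) ((n + k) %/ d - n %/ d)%:R
     - k%:R * (ln D%:R - ln k%:R) / e%:R| <= ln D%:R - ln k%:R + 3 + 2 * E.
Proof.
move=> e0 ek kD E1 E2; rewrite sum_dvd_reindex //.
have eR : 0 < e%:R :> R by rewrite ltr0n.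
have kR : 0 < k%:R :> R by rewrite ltr0n; lia.
rewrite (eq_bigr (fun d => ((n + k) %/ e %/ d - n %/ e %/ d)%:R)) => [|d _]; last by rewrite !divnMA.
rewrite sum_divn_diff ?leq_div2r ?leq_addr //.
have S0 : 0 <= \sum_((k %/ e).+1 <= d < (D %/ e).+1) (d%:R)^-1 :> R.
  by apply: sumr_ge0 => d _; rewrite invr_ge0 ler0n.
have := sum_inv_quotient R e0 ek kD; move: E1 E2 S0.
move: (\sum_(_ <= d < _) saw _ _ _) (\sum_(_ <= d < _) saw _ _ _) => s1 s2.
move: (\sum_(_ <= d < _) _) (ln D%:R - ln k%:R) => S L.
rewrite !ler_norml => /andP[a1 a2] /andP[b1 b2] S0 /andP[c1 c2].
have /andP[f1 f2] := divn_natr_bounds R n e0.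
have /andP[g1 g2] := divn_natr_bounds R (n + k) e0.
rewrite natrD mulrDl in g1 g2.
have -> : k%:R * L / e%:R = k%:R / e%:R * L by ring.
have ke : 2 * e%:R / k%:R <= 1 :> R by rewrite ler_pdivrMr // mul1r -natrM ler_nat.
have ke2 : (k%:R / e%:R) * (2 * e%:R / k%:R) = 2 :> R by field; rewrite !gt_eqF.
have x0 : 0 < k%:R / e%:R :> R by rewrite divr_gt0.
move: (k%:R / e%:R) (2 * e%:R / k%:R) ke ke2 x0 c1 c2 g1 g2 => x dl ke ke2 x0 c1 c2.
move: (n%:R / e%:R) f1 f2 => u; move: ((n %/ e)%:R : R) (((n + k) %/ e)%:R : R) => v w f1 f2 g1 g2.
have h1 : - S <= (w - v - x) * S <= S by apply/andP; split; nra.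
have h2 : x * (S - L) <= x * dl by rewrite ler_pM2l.
have h3 : x * - dl <= x * (S - L) by rewrite ler_pM2l.
have {}h1 := andP h1; case: h1 => h1 h1'.
have -> : (w - v) * S - s1 + s2 - x * L = (w - v - x) * S + x * (S - L) - s1 + s2 by ring.
by apply/andP; split; lra.
Qed.

Lemma leq_div_exp (Z a u v e : nat) : (0 < e <= Z ^ v)%N -> (Z ^ (u + v) <= a)%N -> (Z ^ u <= a %/ e)%N.
Proof.
move=> /andP[e0 eZ] h; rewrite leq_divRL //; apply: leq_trans h.
by rewrite expnD leq_mul2l eZ orbT.
Qed.

(** [saw_sum_le] with [Q = Z ^ 32], [Q0 = Z ^ 8], [M = Z ^ 15]. The bound of order [Z ^ 123] leaves
    room for the sieve's factor [Z ^ 4], since [k >= Z ^ 129], although [d] itself may go up to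
    [Z ^ 131]. *)
Lemma saw_sum_quotient (R : realFieldType) (Z k D y e : nat) :
  (32 <= Z)%N -> (Z ^ 129 <= k)%N -> (k <= D)%N -> (D <= Z ^ 131)%N ->
  (Z ^ 260 <= y <= Z ^ 261)%N -> (0 < e <= Z ^ 2)%N ->
  `|\sum_((k %/ e).+1 <= d < (D %/ e).+1) saw R (y %/ e) d| <= 5 * (Z ^ 123)%:R.
Proof.
move=> Z32 kZ kD DZ /andP[y1 y2] eZ; have /andP[e0 _] := eZ.
have Z1 : (1 < Z)%N by lia.
have Zm i j : (i <= j)%N -> (Z ^ i <= Z ^ j)%N by rewrite leq_exp2l.
have Y1 : (Z ^ 258 <= y %/ e)%N by apply: (leq_div_exp (v := 2)).
have Y2 : (y %/ e <= Z ^ 261)%N by apply: leq_trans (leq_div _ _) y2.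
have A1 : (Z ^ 127 <= k %/ e)%N by apply: (leq_div_exp (v := 2)).
have B1 : (D %/ e <= Z ^ 131)%N by apply: leq_trans (leq_div _ _) DZ.
have AB : (k %/ e <= D %/ e)%N by rewrite leq_div2r.
have BY : (D %/ e <= y %/ e)%N.
  by apply: leq_trans B1 (leq_trans _ Y1); apply: Zm.
move: (k %/ e)%N (D %/ e)%N (y %/ e)%N Y1 Y2 A1 B1 AB BY => a b Y Y1 Y2 A1 B1 AB BY.
have Zs i j : (i < j)%N -> (2 * Z ^ i <= Z ^ j)%N.
  by move=> ij; apply: leq_trans (Zm _ _ ij); rewrite expnS leq_mul2r; apply/orP; right; lia.
have quad : (2 * Y * (Z ^ 32) ^ 3 <= a ^ 3)%N.
  apply: (@leq_trans ((Z ^ 127) ^ 3)); last by rewrite leq_exp2r.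
  rewrite -!expnM -mulnA; apply: (@leq_trans (2 * (Z ^ 261 * Z ^ 96))%N).
    by rewrite leq_mul2l leq_mul2r Y2 orbT.
  by rewrite -expnD; apply: Zs.
have sl : (Z ^ 8 * Y <= Z ^ 15 * a ^ 2)%N.
  apply: (@leq_trans (Z ^ 15 * (Z ^ 127) ^ 2)); last by rewrite leq_mul2l leq_sqr A1 orbT.
  apply: (@leq_trans (Z ^ 8 * Z ^ 261)); first by rewrite leq_mul2l Y2 orbT.
  by rewrite -expnM -!expnD; apply: Zm.
have curv : (b ^ 2 < Y * Z ^ 32)%N.
  apply: (@leq_ltn_trans ((Z ^ 131) ^ 2)); first by rewrite leq_sqr.
  apply: (@leq_trans (Z ^ 258 * Z ^ 32)); last by rewrite leq_mul2r Y1 orbT.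
  by rewrite -expnM -expnD ltn_exp2l.
have Qa : (2 * Z ^ 32 <= a)%N by apply: leq_trans A1; apply: Zs.
have Q1 : (1 < Z ^ 32)%N by rewrite -{1}(expn0 Z) ltn_exp2l.
have Q00 : (0 < Z ^ 8)%N by rewrite expn_gt0; lia.
apply: le_trans (saw_sum_le R Q00 Q1 Qa (introT andP (conj AB BY)) quad sl curv) _.
have t1 : 4 * b%:R / (Z ^ 8)%:R <= 4 * (Z ^ 123)%:R :> R.
  rewrite ler_pdivrMr ?ltr0n // -mulrA ler_pM2l // -natrM ler_nat -expnD.
  exact: B1.
have t2 : (Z ^ 8 * ((Z ^ 15).+2 * (2 * b %/ Z ^ 32).+1) <= 6 * Z ^ 122)%N.
  apply: (@leq_trans (Z ^ 8 * ((2 * Z ^ 15) * (3 * Z ^ 99)))).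
    rewrite leq_mul2l; apply/orP; right; apply: leq_mul.
      have : (2 * Z ^ 0 <= Z ^ 15)%N by apply: Zs.
      by rewrite expn0; move: (Z ^ 15)%N => u; clear; lia.
    have : (2 * b %/ Z ^ 32 <= 2 * Z ^ 99)%N.
      have h99 : (2 * b <= 2 * Z ^ 99 * Z ^ 32)%N.
        by rewrite -mulnA -expnD leq_mul2l; apply/orP; right.
      by have := leq_div2r (Z ^ 32) h99; rewrite mulnK ?(ltnW Q1).
    have : (0 < Z ^ 99)%N by rewrite expn_gt0 (ltnW Z1).
    by move: (2 * b %/ Z ^ 32)%N (Z ^ 99)%N => u v; clear; lia.
  rewrite leq_eqVlt; apply/orP; left; apply/eqP.
  by rewrite (_ : 122 = 8 + (15 + 99))%N // !expnD; ring.
have t3 : (Z ^ 32 <= Z ^ 122)%N by apply: Zm.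
(* [25 = 4 * 6 + 1] collects the last two error terms; [32 <= Z] makes them fit into one
   [Z ^ 123]. *)
have t4 : (25 * Z ^ 122 <= Z ^ 123)%N by rewrite [(Z ^ 123)%N]expnS leq_mul2r; apply/orP; right; lia.
move: t1 t2 t3 t4; move: (4 * b%:R / _) (Z ^ 123)%N (Z ^ 122)%N (Z ^ 32)%N (Z ^ 8 * _)%N.
clear; move=> u1 u2 u3 u4 u5 t1; rewrite -!(ler_nat R) !natrM => t2 t3 t4.
by lra.
Qed.

(** * Prime counts from the sieve *)

Lemma prime_sum_sieve (R : realType) (z B : nat) (w : nat -> R) (X Rm : R) :
  (1 < z)%N -> 0 <= X -> (forall d, 0 <= w d) ->
  (forall e, (0 < e <= z ^ 2)%N -> `|\sum_(d < B | e %| d) w d - X / e%:R| <= Rm) ->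
  \sum_(d < B | prime d && (z < d)%N) w d <= 2 * X / ln z%:R + z%:R ^+ 4 * Rm.
Proof.
move=> z1 X0 w0 hA; apply: le_trans (selberg_sieve (ltnW z1) X0 w0 hA) _.
have l0 : 0 < ln z%:R :> R by rewrite ln_gt0 // ltr1n.
have S0 := selberg_sum_gt0 R (ltnW z1); have := ln_le_selberg_sum R (ltnW z1).
rewrite lerD2r => lS; rewrite ler_pdivrMr // mulrAC ler_pdivlMr //.
by rewrite [2 * X]mulrC -mulrA ler_wpM2l.
Qed.

Lemma prime_count_sieve (R : realType) (z k : nat) : (1 < z)%N ->
  \sum_(d < k.+1 | prime d && (z < d)%N) 1 <= 2 * k%:R / ln z%:R + z%:R ^+ 4 :> R.
Proof.
(* The weight vanishes at 0, which every [e] divides; the multiples then number exactly [k %/ e], so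
   [X = k] and [Rm = 1]. *)
move=> z1; pose w (d : nat) : R := (0 < d)%:R.
rewrite (eq_bigr (fun d : 'I_k.+1 => w d)) => [|d /andP[/prime_gt0 d0 _]]; last by rewrite /w d0.
rewrite -[z%:R ^+ 4]mulr1; apply: prime_sum_sieve => // e /andP[e0 _].
have -> : \sum_(d < k.+1 | e %| d) w d = (k %/ e)%:R.
  rewrite divn_count_dvd natr_sum big_mkcond big_ord_recl /w /= if_same add0r big_add1 big_mkord.
  by apply: eq_bigr => i _ /=; case: (e %| _).
have /andP[h1 h2] := divn_natr_bounds R k e0.
by rewrite ler_norml; apply/andP; split; lra.
Qed.

Lemma count_le_sum_ord (R : numDomainType) (P : pred nat) (s : seq nat) (B : nat) :
  uniq s -> (forall p, p \in s -> P p -> (p < B)%N) ->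
  (count P s)%:R <= \sum_(d < B | P d && ((d : nat) \in s)) 1 :> R.
Proof.
move=> us hB.
rewrite -(big_mkord (fun d => P d && (d \in s)) (fun _ => 1%N%:R : R)) -natr_sum sum1_count ler_nat.
rewrite -!size_filter; apply: uniq_leq_size; first exact: filter_uniq.
by move=> p; rewrite !mem_filter mem_iota add0n subn0 => /andP[Pp ps]; rewrite Pp ps hB.
Qed.

Definition block_primes (n k : nat) : seq nat := primes (\prod_(1 <= i < k.+1) (n + i)).

Lemma prime_dvd_block_multiple (n k p : nat) : prime p -> p %| (\prod_(1 <= i < k.+1) (n + i))%N ->
  (1 <= (n + k) %/ p - n %/ p)%N.
Proof.
move=> p_pr; have p0 := prime_gt0 p_pr.
rewrite Euclid_dvd_prod // big_has => /hasP[i].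
rewrite mem_index_iota => /andP[i1 ik] /dvdnP[m mE].
rewrite subn_gt0; apply: (@leq_trans m); first by rewrite ltn_divLR // -mE; lia.
by rewrite leq_divRL // -mE leq_add2l.
Qed.

(** The sieve of level [Z] with weight the number of [m] such that [n < d * m <= n + k]. A prime
    divisor of the block has weight at least 1, and the main term is [X = k * (ln D - ln k)]. *)
Lemma medium_prime_count (R : realType) (Z k D n : nat) :
  (32 <= Z)%N -> (Z ^ 129 <= k)%N -> (k <= D)%N -> (D <= Z ^ 131)%N ->
  (Z ^ 260 <= n)%N -> (n + k <= Z ^ 261)%N ->
  (count (fun p => (k < p <= D)%N) (block_primes n k))%:R <=
   2 * (k%:R * (ln D%:R - ln k%:R)) / ln Z%:R +
    Z%:R ^+ 4 * (ln D%:R - ln k%:R + 3 + 10 * (Z ^ 123)%:R) :> R.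
Proof.
move=> Z32 kZ kD DZ nZ nkZ; have Z1 : (1 < Z)%N by lia.
have Zk : (Z < k)%N by apply: leq_trans kZ; rewrite -{1}(expn1 Z) ltn_exp2l.
have k0 : (0 < k)%N by apply: leq_trans Zk.
pose w (d : nat) : R := if (k < d)%N then ((n + k) %/ d - n %/ d)%:R else 0.
apply: (@le_trans _ _ (\sum_(d < D.+1 | prime d && (Z < d)%N) w d)).
  apply: le_trans (count_le_sum_ord R (B := D.+1) _ _) _; first exact: primes_uniq.
    by move=> p _ /andP[].
  rewrite big_mkcond [leRHS]big_mkcond; apply: ler_sum => d _.
  have w0 : 0 <= w d by rewrite /w; case: ifP.
  case: ifP => [/andP[/andP[kd dD]]|_]; last by case: ifP.
  rewrite mem_primes => /and3P[d_pr _ dP].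
  by rewrite d_pr (ltn_trans Zk kd) /w kd /= ler1n prime_dvd_block_multiple.
apply: prime_sum_sieve => //.
- by rewrite mulr_ge0 // subr_ge0 ler_ln ?posrE ?ltr0n ?ler_nat // (leq_trans k0).
- by move=> d; rewrite /w; case: ifP.
move=> e eZ; have /andP[e0 eZ'] := eZ.
rewrite -(big_mkord (fun d => e %| d) w) (@big_cat_nat _ _ _ k.+1) //=.
rewrite big_nat_cond big1 ?add0r; last first.
  by move=> d /andP[/andP[_ dk] _]; rewrite /w ltnNge -ltnS dk.
rewrite big_nat_cond (eq_bigr (fun d => ((n + k) %/ d - n %/ d)%:R : R)); last first.
  by move=> d /andP[/andP[kd _] _]; rewrite /w kd.
rewrite -big_nat_cond.
have ten (u : R) : 10 * u = 2 * (5 * u) by ring.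
rewrite ten.
have nk : (n <= n + k)%N by rewrite leq_addr.
apply: sum_multiples_error => //.
- apply: leq_trans kZ; apply: (@leq_trans (Z ^ 3)); last by rewrite leq_exp2l.
  by rewrite expnS leq_mul // (leq_trans _ Z32).
- by apply: saw_sum_quotient => //; rewrite nZ (leq_trans nk).
- by apply: saw_sum_quotient => //; rewrite nkZ (leq_trans nZ).
Qed.

(** * Prime divisors of a block of consecutive integers *)

Lemma prod_consecutive (n k : nat) :
  (\prod_(1 <= i < k.+1) (n + i) = 'C(n + k, k) * k`!)%N.
Proof.
have h : (n`! * \prod_(1 <= i < k.+1) (n + i) = (n + k)`!)%N.
  elim: k => [|k IH]; first by rewrite big_geq // muln1 addn0.
  by rewrite big_nat_recr //= mulnA IH addnS factS mulnC.
have := bin_fact (leq_addl n k); rewrite addnK -h mulnA mulnC => /eqP.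
by rewrite eqn_pmul2l ?fact_gt0 // => /eqP.
Qed.

(** [k ^ k] is at most [(k + 1) ... (2 k) = 'C(2 k, k) * k!], and the binomial coefficient is one
    term of [(1 + 1) ^ (2 k)]. *)
Lemma expn_le_fact (k : nat) : (k ^ k <= 4 ^ k * k`!)%N.
Proof.
apply: (@leq_trans ('C(k + k, k) * k`!)).
  have -> : (k ^ k = \prod_(1 <= i < k.+1) k)%N by rewrite prod_nat_const_nat subSS subn0.
  rewrite -prod_consecutive.
  by rewrite !big_nat; apply: leq_prod => i _; rewrite leq_addr.
rewrite leq_mul2r; apply/orP; right.
have -> : (4 ^ k = (1 + 1) ^ (k + k))%N by rewrite -[(1 + 1)%N]/2%N [(k + k)%N]addnn -mul2n expnM.
have kk : (k < (k + k).+1)%N by rewrite ltnS leq_addr.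
by rewrite expnDn (bigD1 (Ordinal kk)) //= !exp1n !muln1 leq_addr.
Qed.

Lemma binomial_bound (n k : nat) : ('C(n + k, k) * k ^ k <= (4 * (n + k)) ^ k)%N.
Proof.
apply: (@leq_trans ('C(n + k, k) * (4 ^ k * k`!))); first by rewrite leq_mul2l expn_le_fact orbT.
rewrite mulnCA expnMn leq_mul2l; apply/orP; right.
have -> : ((n + k) ^ k = \prod_(1 <= i < k.+1) (n + k))%N by rewrite prod_nat_const_nat subSS subn0.
rewrite -prod_consecutive.
by rewrite !big_nat; apply: leq_prod => i /andP[_ ik]; rewrite leq_add2l.
Qed.

Lemma prod_primes_dvd (s : seq nat) (m : nat) :
  uniq s -> all prime s -> all (fun p => p %| m) s -> ((\prod_(p <- s) p)%N %| m)%N.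
Proof.
elim: s => [|p s IH]; first by rewrite big_nil dvd1n.
move=> /= /andP[ps us] /andP[p_pr s_pr] /andP[pm sm]; rewrite big_cons.
have cop : coprime p (\prod_(q <- s) q)%N.
  rewrite prime_coprime // Euclid_dvd_prod // big_has; apply/hasPn => q qs.
  rewrite dvdn_prime2 ?(allP s_pr q qs) //.
  by apply: contraNneq ps => ->.
by rewrite (Gauss_dvd m cop) pm IH.
Qed.

(** A prime above [k] dividing the block product ['C(n + k, k) * k!] does not divide [k!], so the
    product of all these primes divides the binomial coefficient. Each is bounded below by [k] or by
    [D]. *)
Lemma large_primes_le_binomial (n k D : nat) : (k <= D)%N ->
  (k ^ count (fun p => k < p <= D)%N (block_primes n k) *
   D ^ count (fun p => D < p)%N (block_primes n k) <= 'C(n + k, k))%N.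
Proof.
move=> kD; rewrite /block_primes; set s := primes _.
apply: (@leq_trans (\prod_(p <- s | (k < p)%N) p)).
  elim: s => [|p s IH]; first by rewrite big_nil.
  rewrite big_cons /= !expnD mulnACA.
  case: (ltnP k p) => kp; last by rewrite ltnNge (leq_trans kp kD) /= !expn0 !mul1n.
  apply: leq_mul IH; case: (leqP p D) => pD /=; rewrite ?expn1 ?expn0 ?muln1 ?mul1n //; exact: ltnW.
apply: dvdn_leq; first by rewrite bin_gt0 leq_addl.
rewrite -big_filter; apply: prod_primes_dvd; first by rewrite filter_uniq ?primes_uniq.
  by apply/allP => p; rewrite mem_filter mem_primes => /andP[_ /and3P[]].
apply/allP => p; rewrite mem_filter mem_primes => /andP[kp /and3P[p_pr _]].
rewrite prod_consecutive Euclid_dvdM // => /orP[//|pk].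
have : ~~ (p %| k`!)%N; last by rewrite pk.
rewrite fact_prod Euclid_dvd_prod // big_has; apply/hasPn => i.
rewrite mem_index_iota => /andP[i0 ik]; rewrite gtnNdvd //; exact: leq_ltn_trans kp.
Qed.

(** Let [k = t ^ u] and let [s0], [s1], [s2] count the small, medium and large primes. Comparing
    exponents of [t] gives [u * s1 + (u + 4) * s2 <= (u + 3) * k]; subtracting this from [u + 4]
    times [k <= s0 + s1 + s2] eliminates [s2]. *)
Lemma prime_class_counts (t u n : nat) : (1 < t)%N ->
  (4 * (n + t ^ u) <= t ^ (2 * u + 3))%N ->
  (t ^ u <= size (block_primes n (t ^ u)))%N ->
  (t ^ u <= (u + 4) * count (fun p => p <= t ^ u)%N (block_primes n (t ^ u))
            + 4 * count (fun p => t ^ u < p <= t ^ (u + 4))%N (block_primes n (t ^ u)))%N.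
Proof.
move=> t1 nk; set s := block_primes _ _ => ks.
have kD : (t ^ u <= t ^ (u + 4))%N by rewrite leq_exp2l // leq_addr.
have := large_primes_le_binomial n kD; rewrite -/s.
have := binomial_bound n (t ^ u).
have szs : (size s = count (fun p => p <= t ^ u) s + count (fun p => t ^ u < p <= t ^ (u + 4)) s
   + count (fun p => t ^ (u + 4) < p) s)%N.
  elim: (s) => //= p r ->.
  case: (leqP p (t ^ u)) => h1; first by rewrite ltnNge (leq_trans h1 kD) /=; lia.
  by case: (leqP p (t ^ (u + 4))) => h2 /=; lia.
move: ks; rewrite szs.
pose s0 := count (fun p => p <= t ^ u)%N s.
pose s1 := count (fun p => t ^ u < p <= t ^ (u + 4))%N s.
pose s2 := count (fun p => t ^ (u + 4) < p)%N s.
rewrite -/s0 -/s1 -/s2; move: nk; clearbody s0 s1 s2; set k := (t ^ u)%N => nk ks bk sb.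
have : (t ^ (u * s1 + (u + 4) * s2 + u * k) <= t ^ ((2 * u + 3) * k))%N.
  rewrite !expnD [X in (_ <= X)%N]expnM !(expnM t); apply: leq_trans (leq_trans _ bk) _.
    by rewrite leq_mul2r sb orbT.
  by rewrite leq_exp2r // expn_gt0 (ltnW t1).
rewrite leq_exp2l // => h; have h2 := leq_mul (leqnn (u + 4)) ks.
by move: h h2; clear; lia.
Qed.

Lemma small_prime_count (R : realType) (Z n k : nat) : (1 < Z)%N ->
  (count (fun p => p <= k)%N (block_primes n k))%:R <=
    2 * k%:R / ln Z%:R + Z%:R ^+ 4 + Z.+1%:R :> R.
Proof.
move=> Z1; apply: le_trans (count_le_sum_ord R (B := k.+1) _ _) _; first exact: primes_uniq.
  by move=> p _; rewrite ltnS.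
apply: le_trans (lerD (prime_count_sieve R k Z1) (lexx _)).
(* [Z + 1] is split into the number of [d <= min(k, Z)] and a nonnegative slack, so that the rest is
   a termwise comparison. *)
have <- : \sum_(d < k.+1 | (d <= Z)%N) 1 + (Z.+1%:R - \sum_(d < k.+1 | (d <= Z)%N) 1) = Z.+1%:R :> R.
  by rewrite addrC subrK.
rewrite addrA -[leLHS]addr0 lerD //; last first.
  rewrite subr_ge0 -(big_mkord (fun d => d <= Z)%N (fun _ => 1%N%:R : R)) -natr_sum sum1_count ler_nat.
  rewrite -size_filter -[leqRHS](size_iota 0); apply: uniq_leq_size.
    by rewrite filter_uniq ?iota_uniq.
  by move=> p; rewrite mem_filter mem_iota ltnS => /andP[].
rewrite [leLHS]big_mkcond [X in _ <= X + _]big_mkcond [X in _ <= _ + X]big_mkcond -big_split.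
apply: ler_sum => d _ /=; rewrite mem_primes.
case: (prime d); rewrite ?andbF /=; last by case: ifP; rewrite ?addr0 ?add0r.
by case: (leqP d Z) => _; case: ifP; rewrite ?addr0 ?add0r.
Qed.

(* Since [t ^ (u + 4) / t ^ u = t ^ 4] and [Z = t ^ 64], the sieve bounds the
   number of primes in the middle range by [2 * 4 / 64 = 1 / 8] of the length. *)
Lemma block_primes_lt (R : realType) (t u n : nat) : let Z := (t ^ 64)%N in
  (32 <= Z)%N -> (Z ^ 129 <= t ^ u)%N -> (t ^ (u + 4) <= Z ^ 131)%N -> (Z ^ 260 <= n)%N ->
  (n + t ^ u <= Z ^ 261)%N -> (4 * (n + t ^ u) <= t ^ (2 * u + 3))%N ->
  (16 * (u + 4))%:R <= ln Z%:R :> R ->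
  (size (block_primes n (t ^ u)) < t ^ u)%N.
Proof.
move=> Z Z32 kZ DZ nZ nkZ nk4 lnZ.
have t1 : (1 < t)%N.
  by move: Z32; rewrite /Z; case: (t) => [|[|//]]; rewrite ?exp1n ?exp0n.
have Z1 : (1 < Z)%N by apply: leq_trans Z32.
rewrite ltnNge; apply/negP => big.
have := prime_class_counts t1 nk4 big; rewrite leqNgt => /negP; apply.
have kD : (t ^ u <= t ^ (u + 4))%N by rewrite leq_exp2l // leq_addr.
have tR : 0 < t%:R :> R by rewrite ltr0n ltnW.
have ZR : 0 < Z%:R :> R by rewrite ltr0n ltnW.
have LE : ln (t ^ (u + 4))%:R - ln (t ^ u)%:R = ln Z%:R / 16 :> R.
  rewrite /Z !natrX !lnXn // mulrnDr addrAC subrr add0r -(mulr_natl _ 64) -(mulr_natl _ 4).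
  by field.
have m := medium_prime_count R Z32 kZ kD DZ nZ nkZ; rewrite LE in m.
have s := small_prime_count R n (t ^ u) Z1.
rewrite -(ltr_nat R) natrD !natrM.
have lnZ0 : 0 < ln Z%:R :> R by rewrite ln_gt0 // ltr1n.
have lnZZ : ln Z%:R <= Z%:R :> R by apply/ltW/ln_sublinear.
have k7 : (96 * Z ^ 5 <= t ^ u)%N.
  apply: leq_trans kZ; apply: (@leq_trans (Z ^ 7)); last by rewrite leq_exp2l.
  rewrite (_ : 7 = 2 + 5)%N // expnD leq_mul2r; apply/orP; right.
  by apply: (@leq_trans (32 * 32)) => //; rewrite -mulnn leq_mul.
have k129 : (176 * Z ^ 127 <= t ^ u)%N.
  apply: leq_trans kZ; rewrite (_ : 129 = 2 + 127)%N // expnD leq_mul2r; apply/orP; right.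
  by apply: (@leq_trans (32 * 32)) => //; rewrite -mulnn leq_mul.
have Z123 : (Z + 3 <= Z ^ 123)%N.
  apply: (@leq_trans (Z ^ 2)); last by rewrite leq_exp2l.
  by rewrite -mulnn; move: Z32; clear; nia.
have k0 : (0 < t ^ u)%N by rewrite expn_gt0 (ltnW t1).
have P127 : Z%:R ^+ 4 * (Z ^ 123)%:R = (Z ^ 127)%:R :> R by rewrite -natrX -natrM -expnD.
move: k7 k129 Z123 k0 lnZ m s.
move: (count (fun p => p <= _)%N _) (count _ _) => s0 s1.
move: (ln Z%:R) lnZ0 lnZZ => l l0 lz.
move: (t ^ u)%N (Z ^ 123)%N (Z ^ 127)%N P127 (ltW ZR) => k P N PN z0.
rewrite -(ler1n R) -!(ler_nat R) natrM natrX natrM natrD natrM -[Z.+1%:R]natr1.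
have : 32 <= Z%:R :> R by rewrite (ler_nat R 32).
move: (Z%:R : R) (k%:R : R) (P%:R : R) (N%:R : R) (s0%:R : R) (s1%:R : R) ((u + 4)%:R : R)
  (ler0n R (u + 4)) PN z0 lz => z K p N' x0 x1 U U0 PN z0 lz z32 k7 k129 zp k0 Ul m s.
clear -U0 l0 PN z0 lz z32 k7 k129 zp k0 Ul m s.
have h1 : U * (2 * K / l) <= K / 8.
  by rewrite mulrA ler_pdivrMr //; nra.
have h2 : 2 * (K * (l / 16)) / l = K / 8 by field; rewrite gt_eqF.
have h3 : z ^+ 4 * (l / 16 + 3 + 10 * p) <= 11 * N'.
  have -> : 11 * N' = z ^+ 4 * (11 * p) by rewrite -PN; ring.
  by rewrite ler_wpM2l ?exprn_ge0 //; lra.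
have h4 : U * (z ^+ 4 + (z + 1)) <= 3 / 16 * z ^+ 5.
  have z4 : z + 1 <= 2 * z ^+ 4.
    have : z <= z ^+ 4 by rewrite ler_eXnr //; lra.
    by lra.
  have -> : 3 / 16 * z ^+ 5 = z / 16 * (3 * z ^+ 4) by field.
  by apply: ler_pM => //; [rewrite addr_ge0 ?exprn_ge0 //; lra|lra|lra].
have h5 : U * x0 <= U * (2 * K / l + z ^+ 4 + (z + 1)) by rewrite ler_wpM2l.
rewrite -addrA mulrDr in h5; rewrite h2 in m.
(* Shares of [K]: small primes take [1/8 + 1/512], medium ones [4 * (1/8)] and [44 * N' <= K / 4];
   together less than 1. *)
by lra.
Qed.

(** With [Z = t ^ 64] the choice of [u] gives [t ^ u.+1 = Z ^ 130]. So [n] is at least [Z ^ 260],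
    and the block length [t ^ u] is a factor [t] below [Z ^ 130]. *)
Lemma eventually_block_primes_lt (R : realType) (u : nat) : u.+1 = (64 * 130)%N ->
  exists T : nat, (1 < T)%N /\ forall t n : nat, (T <= t)%N ->
    (t ^ (2 * u.+1) <= n < t.+1 ^ (2 * u.+1))%N ->
    (size (block_primes n (t ^ u)) < t ^ u)%N.
Proof.
move=> uE; pose T1 := Num.bound (expR (u + 4)%:R : R).
(* [T1] makes [ln t >= u + 4], hence [ln Z >= 16 * (u + 4)]; the power of 2 absorbs the constants in
   [4 * (n + t ^ u)] into one more factor [t]. *)
exists (maxn T1 (2 ^ (2 * u + 5))); split.
  by rewrite leq_max; apply/orP; right; rewrite -{1}(expn0 2) ltn_exp2l // addnS.
move=> t n; rewrite geq_max => /andP[tT1 tT2] /andP[n1 n2].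
have t2 : (2 <= t)%N by apply: leq_trans tT2; rewrite -{1}(expn1 2) leq_exp2l // addnS.
have tle i j : (i <= j)%N -> (t ^ i <= t ^ j)%N by rewrite leq_exp2l.
have n4 : (4 * (n + t ^ u) <= t ^ (2 * u + 3))%N.
  have h1 : (t.+1 ^ (2 * u.+1) <= 2 ^ (2 * u.+1) * t ^ (2 * u.+1))%N.
    by rewrite -expnMn leq_exp2r ?muln_gt0 // mul2n -addnn -addn1 leq_add2l ltnW.
  have h2 : (t ^ u <= 2 ^ (2 * u.+1) * t ^ (2 * u.+1))%N.
    apply: (@leq_trans (t ^ (2 * u.+1))); first by apply: tle; lia.
    by rewrite leq_pmull // expn_gt0.
  apply: (@leq_trans (2 ^ (2 * u + 5) * t ^ (2 * u.+1))).
    rewrite (_ : 2 * u + 5 = 3 + 2 * u.+1)%N; last by lia.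
    by rewrite [(2 ^ (3 + _))%N]expnD -mulnA; move: h1 h2 n2; clear; lia.
  rewrite (_ : 2 * u + 3 = 1 + 2 * u.+1)%N; last by lia.
  by rewrite [(t ^ (1 + _))%N]expnD expn1 leq_mul2r tT2 orbT.
apply: (@block_primes_lt R) => //; rewrite -?expnM.
- by apply: (@leq_trans (2 ^ 64)) => //; rewrite leq_exp2r.
- by apply: tle; lia.
- by apply: tle; lia.
- by apply: leq_trans n1; apply: tle; lia.
- apply: leq_trans (leq_trans _ n4) _; last by apply: tle; lia.
  by rewrite leq_pmull.
have tR : 0 < t%:R :> R by rewrite ltr0n ltnW.
rewrite natrX lnXn // (_ : 16 * (u + 4) = (u + 4) * 16)%N; last by lia.
have h : (u + 4)%:R <= ln t%:R :> R.
  rewrite -[leLHS](@expRK R) ler_ln ?posrE ?expR_gt0 //.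
  apply: le_trans (_ : T1%:R <= _); last by rewrite ler_nat.
  by apply/ltW/archi_boundP; rewrite expR_ge0.
rewrite natrM -[leRHS]mulr_natr; apply: ler_pM; rewrite ?ler0n //.
by rewrite ler_nat.
Qed.

Local Close Scope ring_scope.

(** * From block primes to [g] and [g1] *)

Lemma prime_rep_g1_prop (n k : nat) : prime_rep n k -> g1_prop n k.
Proof.
move=> [P [P_inj hP]] l /andP[l0 lk]; rewrite /omega.
(* The first [l] primes of the representation are distinct divisors of the product of the first [l]
   terms. *)
pose s := [seq P (widen_ord lk j) | j <- enum 'I_l].
apply: (@leq_trans (size s)); first by rewrite size_map size_enum_ord.
apply: uniq_leq_size.
  rewrite map_inj_uniq ?enum_uniq // => i j /P_inj /(congr1 val) /= ij; exact: val_inj.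
move=> p /mapP[j _ ->]; have [p_pr pd] := hP (widen_ord lk j).
rewrite mem_primes p_pr /= big_nat prodn_cond_gt0 /= => [|i /andP[i0 _]]; last by rewrite addn_gt0 i0 orbT.
rewrite -big_nat Euclid_dvd_prod // big_has; apply/hasP; exists j.+1 => //.
by rewrite mem_index_iota /=; apply: (ltn_ord j).
Qed.

(** Excluded middle turns [P] into a boolean predicate, so that the bounded maximum [ex_maxnP]
    applies. *)
Lemma exists_max_nat (P : nat -> Prop) (B : nat) : P 1 ->
  (forall k, 0 < k -> P k -> k < B) ->
  exists k, 0 < k /\ P k /\ forall k', 0 < k' -> P k' -> k' <= k.
Proof.
move=> P1 PB.
have ex : exists k, (0 < k) && `[< P k >] by exists 1; apply/andP; split=> //; apply/asboolP.
have ub k : (0 < k) && `[< P k >] -> k <= B by move=> /andP[k0 /asboolP Pk]; apply/ltnW/PB.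
have [k /andP[k0 /asboolP Pk] kmax] := ex_maxnP ex ub.
exists k; split=> //; split=> // k' k0' Pk'; apply: kmax; rewrite k0'; exact/asboolP.
Qed.

Lemma INR_expn (t u : nat) : INR (t ^ u) = pow (INR t) u.
Proof. by elim: u => [|u IH] //; rewrite expnS -multE mult_INR IH. Qed.

(** [t ^ u] is the power of [t ^ (2 * u.+1)] with exponent [u / (2 * u.+1)], and that power is
    monotone. *)
Lemma INR_lt_Rpower (k n t u : nat) : 1 < t -> k < t ^ u -> t ^ (2 * u.+1) <= n ->
  Rlt (INR k) (Rpower (INR n) (Rdiv (INR u) (INR (2 * u.+1)))).
Proof.
move=> t1 kt tn.
have t0 : Rlt 0 (INR t) by apply: lt_0_INR; apply/ssrnat.ltP; apply: ltnW.
have w0 : INR (2 * u.+1) <> R0 by apply: not_0_INR.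
apply: (Rlt_le_trans _ (INR (t ^ u))); first by apply: lt_INR; apply/ssrnat.ltP.
rewrite INR_expn -Rpower_pow //.
rewrite {1}(_ : INR u = Rmult (INR (2 * u.+1)) (Rdiv (INR u) (INR (2 * u.+1)))); last first.
  by rewrite /Rdiv Rmult_comm Rmult_assoc Rinv_l // Rmult_1_r.
rewrite -Rpower_mult; apply: Rle_Rpower_l.
  by apply: Rle_mult_inv_pos; [apply: pos_INR | apply: lt_0_INR; apply/ssrnat.ltP].
rewrite Rpower_pow // -INR_expn; split; last by apply: le_INR; apply/ssrnat.leP.
by apply: lt_0_INR; apply/ssrnat.ltP; rewrite expn_gt0 ltnW.
Qed.

Theorem theorem1p3 :
  exists gamma : R, Rlt 0 gamma /\ Rlt gamma (Rdiv 1 2) /\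
    exists N : nat, forall n : nat, N <= n ->
      exists k k1 : nat, is_g n k /\ is_g1 n k1 /\
        k <= k1 /\ Rlt (INR k1) (Rpower (INR n) gamma).
Proof.
(* [u = 8319], so the exponent [gamma] below is [8319 / 16640]; the equation keeps [u] opaque in the
   powers. *)
have [u uE] : exists u, u.+1 = 64 * 130 by exists (64 * 130).-1.
have u0 : 0 < u by lia.
have [T [T1 hT]] := eventually_block_primes_lt Rdefinitions.R uE.
have uR : Rlt 0 (INR u) by apply: lt_0_INR; apply/ssrnat.ltP.
have wE : INR (2 * u.+1) = Rmult 2 (Rplus (INR u) 1) by rewrite -multE mult_INR (S_INR u).
exists (Rdiv (INR u) (INR (2 * u.+1))); split; last split.
- by apply: Rdiv_lt_0_compat => //; rewrite wE; Lra.lra.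
- rewrite wE; apply: (Rmult_lt_reg_r (Rmult 2 (Rplus (INR u) 1))); first by Lra.lra.
  by rewrite /Rdiv Rmult_assoc Rinv_l; Lra.lra.
exists (T ^ (2 * u.+1)) => n Tn.
have n0 : 0 < n by apply: leq_trans Tn; rewrite expn_gt0 (ltnW T1).
have ex : exists t, t ^ (2 * u.+1) <= n by exists T.
have ub t : t ^ (2 * u.+1) <= n -> t <= n.
  by apply: leq_trans; rewrite -{1}(expn1 t); case: t => // t; rewrite leq_pexp2l.
(* [t] is the integer part of the root of [n] of order [2 * u.+1]. *)
have [t tn tmax] := ex_maxnP ex ub.
have Tt : T <= t by apply: tmax.
have nt : n < t.+1 ^ (2 * u.+1) by rewrite ltnNge; apply/negP => /tmax; rewrite ltnn.
have few := hT t n Tt (introT andP (conj tn nt)).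
(* A [k >= t ^ u] would have to satisfy the defining inequality at [l = t ^ u], where it fails by
   [few]. *)
have g1_lt k : 0 < k -> g1_prop n k -> k < t ^ u.
  move=> k0 hk; rewrite ltnNge; apply/negP => uk.
  have := hk (t ^ u); rewrite uk expn_gt0 (leq_trans (ltnW T1) Tt) => /(_ isT).
  by rewrite leqNgt => /negP; apply.
have rep1 : prime_rep n 1.
  exists (fun _ => pdiv n.+1); split; first by move=> i j _; rewrite !ord1.
  by move=> j; rewrite !ord1 /= addn1 pdiv_prime ?pdiv_dvd.
have [k [k0 [hk kmax]]] := exists_max_nat rep1 (fun k k0 h => g1_lt k k0 (prime_rep_g1_prop h)).
have [k1 [k10 [hk1 k1max]]] := exists_max_nat (prime_rep_g1_prop rep1) g1_lt.
exists k, k1; do 2!(split; first by []); split; first by apply: k1max => //; apply: prime_rep_g1_prop.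
by apply: (INR_lt_Rpower (leq_trans T1 Tt) (g1_lt k1 k10 hk1) tn).
Qed.
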